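(* Let $r$ be a positive integer, $\boldsymbol{\omega}=(\omega_1,\ldots,\omega_r)$ positive reals, $a\ge0$, and let $m$ be an integer with $1\le m\le r$. Then \[ c_{r,m}(\boldsymbol{\omega},a)=\sum_{k=0}^m(-1)^{m-k}\frac{(r-m+k)!}{k!}\,\Lambda_{m-k}\Bigl(\frac{\boldsymbol{\omega}}{a+|\boldsymbol{\omega}|}\Bigr)\,B_k\bigl(0,-1!\zeta(2),2!\zeta(3),\ldots,(-1)^{k-1}(k-1)!\zeta(k)\bigr). \]
   Context: $R=\{1,\ldots,r\}$; for $J\subset R$, $|\boldsymbol{\omega}_J|=\sum_{j\in J}\omega_j$ ($|\boldsymbol{\omega}_\emptyset|=0$), $|\boldsymbol{\omega}|=|\boldsymbol{\omega}_R|$. Multiple polylogarithm: $\mathrm{Li}_{\boldsymbol{k}}(z_1,\ldots,z_s)=\sum_{1\le n_1<\cdots<n_s}\frac{z_1^{n_1}\cdots z_s^{n_s}}{n_1^{k_1}\cdots n_s^{k_s}}$ for $\boldsymbol{k}\in(\mathbb{Z}_{\ge1})^s$, $|z_i|<1$. \[ c_{r,m}(\boldsymbol{\omega},a)=\sum_{t=1}^{\min\{m,r\}}(-1)^{m-t}\sum_{s=1}^t\sum_{\substack{\boldsymbol{k}\in(\mathbb{Z}_{\ge1})^s\\k_1+\cdots+k_s=t}}\sum_{\substack{\boldsymbol{l}\in(\mathbb{Z}_{\ge0})^s\\l_1+\cdots+l_s=m-t}}(r-t)!\,k_1!\cdots k_s!\prod_{i=1}^s\binom{k_i+l_i-1}{l_i}\sum_{K_1,\ldots,K_s}\mathrm{Li}_{\boldsymbol{k}+\boldsymbol{l}}(z_1,\ldots,z_s),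 \] where $(K_1,\ldots,K_s)$ runs over ordered tuples of pairwise disjoint subsets of $R$ with $|K_i|=k_i$, $K_0=R\setminus\bigsqcup_iK_i$, and $z_j=\frac{a+|\boldsymbol{\omega}_{K_0\sqcup\cdots\sqcup K_{j-1}}|}{a+|\boldsymbol{\omega}_{K_0\sqcup\cdots\sqcup K_j}|}$. For an $r$-tuple $\boldsymbol{v}$ of positive reals, $\Lambda_0(\boldsymbol{v})=1$ and $\Lambda_k(\boldsymbol{v})=\sum_{1\le i_1<\cdots<i_k\le r}\log v_{i_1}\cdots\log v_{i_k}$ for $k\ge1$; here $\boldsymbol{\omega}/(a+|\boldsymbol{\omega}|)=(\omega_1/(a+|\boldsymbol{\omega}|),\ldots,\omega_r/(a+|\boldsymbol{\omega}|))$. $\zeta$ is the Riemann zeta function. The complete exponential Bell polynomials are defined by $B_0=1$ and $B_{n+1}(x_1,\ldots,x_{n+1})=\sum_{s=0}^n\binom{n}{s}x_{s+1}B_{n-s}(x_1,\ldots,x_{n-s})$. *)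

(* Defs.v *)
From HB Require Import structures.
From mathcomp Require Import all_boot all_order all_algebra.
From mathcomp Require Import all_classical all_reals all_analysis.

Set Implicit Arguments.
Unset Strict Implicit.
Unset Printing Implicit Defensive.

Import Order.TTheory GRing.Theory Num.Theory.
Import numFieldNormedType.Exports.

Local Open Scope ring_scope.

(* 1 <= n_0 < n_1 < ... < n_(s-1) *)
Definition incr_pos (s N : nat) (n : {ffun 'I_s -> 'I_N.+1}) : bool :=
  [forall i, (0 < n i)%N] &&
  [forall i : 'I_s, forall j : 'I_s, (i < j)%N ==> (n i < n j)%N].

(* Only meaningful when the multiple series converges, e.g. for
   |z_i| < 1 for all i, where it converges absolutely; the truncation
   is on the largest index, n_(s-1) <= N. *)
Definition Li (R : realType) (s : nat) (k : 'I_s -> nat) (z : 'I_s -> R) : R :=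
  limn (fun N : nat =>
    \sum_(n : {ffun 'I_s -> 'I_N.+1} | incr_pos n)
      \prod_(i < s) (z i ^+ n i / (n i)%:R ^+ k i)).

(* The Riemann zeta function at integers k >= 2; junk for k <= 1. *)
Definition zeta (R : realType) (k : nat) : R :=
  limn (series (fun n : nat => ((n.+1)%:R ^+ k)^-1 : R)).

Definition wsum (R : realType) (r : nat) (omega : 'I_r -> R)
    (J : {set 'I_r}) : R :=
  \sum_(j in J) omega j.

Definition pairwise_disjoint (r s : nat) (K : {ffun 'I_s -> {set 'I_r}}) : bool :=
  [forall i : 'I_s, forall j : 'I_s, (i != j) ==> [disjoint K i & K j]].

(* K_0 \cup K_1 \cup ... \cup K_j, where K_0 is the complement of
   K_1 \cup ... \cup K_s and K_(i+1) is stored as K i for i : 'I_s. *)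
Definition Kupto (r s : nat) (K : {ffun 'I_s -> {set 'I_r}}) (j : nat) :
    {set 'I_r} :=
  (~: \bigcup_(i < s) K i) :|: \bigcup_(i < s | (i < j)%N) K i.

(* zarg omega a K j is z_(j+1). *)
Definition zarg (R : realType) (r s : nat) (omega : 'I_r -> R) (a : R)
    (K : {ffun 'I_s -> {set 'I_r}}) (j : 'I_s) : R :=
  (a + wsum omega (Kupto K j)) / (a + wsum omega (Kupto K j.+1)).

(* The bounds in 'I_t.+1 and 'I_(m - t).+1 are implied by the constraints
   on the sums. *)
Definition c_coef (R : realType) (r m : nat) (omega : 'I_r -> R) (a : R) : R :=
  \sum_(1 <= t < (minn m r).+1) (-1) ^+ (m - t) *
  \sum_(1 <= s < t.+1)
  \sum_(k : {ffun 'I_s -> 'I_t.+1} |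
        [forall i, (0 < k i)%N] && ((\sum_(i < s) k i)%N == t))
  \sum_(l : {ffun 'I_s -> 'I_(m - t).+1} | (\sum_(i < s) l i)%N == (m - t)%N)
    ((r - t)`! * (\prod_(i < s) (k i)`!)
       * \prod_(i < s) 'C(k i + l i - 1, l i))%N%:R *
    \sum_(K : {ffun 'I_s -> {set 'I_r}} |
          pairwise_disjoint K && [forall i, #|K i| == k i])
      Li (fun i : 'I_s => (k i + l i)%N) (zarg omega a K).

(* Index tuples i_1 < ... < i_k are encoded as k-element subsets. *)
Definition Lam (R : realType) (r k : nat) (v : 'I_r -> R) : R :=
  \sum_(A : {set 'I_r} | #|A| == k) \prod_(i in A) ln (v i).

(* x : nat -> R lists the arguments from index 1 (x 0 is never read):
   bell x n is B_n(x 1, ..., x n). *)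
Fixpoint bell (R : realType) (x : nat -> R) (n : nat) {struct n} : R :=
  if n is n'.+1 then
    \sum_(s < n'.+1) 'C(n', s)%:R * x s.+1 * bell x (n' - s)
  else 1.

(* The sequence 0, -1! zeta(2), 2! zeta(3), ... of index 1, 2, 3, ... *)
Definition zeta_arg (R : realType) (j : nat) : R :=
  if (j <= 1)%N then 0 else (-1) ^+ j.-1 * (j.-1)`!%:R * zeta R j.

(* Main.v *)
(** Write p_i = omega_i / A and p_0 = a / A with A = a + |omega|, and let H_n be
    the n-th harmonic number. Truncate every Li at n_s <= M.

    The data (s, K_1, ..., K_s, n_1 < ... < n_s) amount to a single map N from R
    to {0, ..., M} (N = n_i on K_i and N = 0 on K_0), and the product of the
    z_i^(n_i) telescopes to the product over n < M of the masses
    p_0 + sum_{N_j <= n} p_j. Since binom(k+l-1, l) (-1)^l / n^(k+l) is the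
    coefficient of X^l in (n + X)^-k, the truncated c_{r,m} is the coefficient of
    X^m of a polynomial [lev M R] that satisfies a first-order recursion in M.

    That recursion has a closed solution: modulo X^(r+1),
      lev M R = prod_{n <= M} (1 + X/n) *
        E[ sum_{B subset R} (r - |B|)! X^|B| prod_{i in B} (- H_{N_i}) ],
    where N is now multinomial with parameters M and p. Multiplying the first
    factor by exp(- H_M X) turns it into the generating function of the Bell
    polynomials at truncated zeta values, and multiplying the second by
    exp(H_M X) replaces - H_{N_i} by H_M - H_{N_i}, which tends to - log p_i by
    the law of large numbers. *)
Require Import Defs.
From mathcomp Require Import all_boot all_order all_algebra.
From mathcomp Require Import all_classical all_reals all_analysis.
From mathcomp Require Import ring lra.

Set Implicit Arguments.
Unset Strict Implicit.
Unset Printing Implicit Defensive.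

Import Order.TTheory GRing.Theory Num.Theory.
Import numFieldNormedType.Exports.

Local Open Scope ring_scope.

(** * Multinomial expectation *)

Section Multinomial.
Variables (R : numFieldType) (I : finType) (p0 : R) (p : I -> R).

(** The count vector after one more letter [j] has been drawn. *)
Definition incr (N : I -> nat) (j i : I) : nat := (N i + (i == j))%N.

Lemma incrC N i j : incr (incr N i) j = incr (incr N j) i.
Proof. by apply/funext => k; rewrite /incr addnAC. Qed.

Lemma incr_id N i : incr N i i = (N i).+1.
Proof. by rewrite /incr eqxx addn1. Qed.

Lemma incr_neq N i j : i != j -> incr N j i = N i.
Proof. by rewrite /incr => /negPf ->; rewrite addn0. Qed.

(* [mexp S M phi] is the unnormalised expectation of [phi] at the vector of
   counts of M independent letters drawn from S plus one uncounted letter of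
   weight p0. *)
Fixpoint mexp (V : lmodType R) (S : {set I}) (M : nat)
    (phi : (I -> nat) -> V) : V :=
  if M is M'.+1 then
    p0 *: mexp S M' phi +
    \sum_(j in S) p j *: mexp S M' (fun N => phi (incr N j))
  else phi (fun=> 0%N).

Section Linear.
Variable V : lmodType R.
Implicit Types (phi psi : (I -> nat) -> V) (S : {set I}).

Lemma mexp_ext S M phi psi : phi =1 psi -> mexp S M phi = mexp S M psi.
Proof. by move=> /funext ->. Qed.

Lemma mexp0 S M : mexp S M (fun=> 0 : V) = 0.
Proof.
elim: M => //= M ->; rewrite scaler0 add0r big1 // => j _.
by rewrite scaler0.
Qed.

Lemma mexpD S M phi psi :
  mexp S M (fun N => phi N + psi N) = mexp S M phi + mexp S M psi.
Proof.
elim: M phi psi => //= M IH phi psi; rewrite IH scalerDr.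
under eq_bigr do rewrite IH scalerDr.
by rewrite big_split addrACA.
Qed.

Lemma mexp_sum (J : Type) (s : seq J) (P : pred J)
    (phi : J -> (I -> nat) -> V) S M :
  mexp S M (fun N => \sum_(k <- s | P k) phi k N) =
  \sum_(k <- s | P k) mexp S M (phi k).
Proof.
elim: s => [|k s IH].
  rewrite big_nil -[RHS](mexp0 S M); apply: mexp_ext => N; exact: big_nil.
rewrite big_cons; case: ifP => Pk.
  by rewrite -IH -mexpD; apply: mexp_ext => N; rewrite big_cons Pk.
by rewrite -IH; apply: mexp_ext => N; rewrite big_cons Pk.
Qed.

Lemma mexp_linear (W : lmodType R) (f : {linear V -> W}) S M phi :
  mexp S M (fun N => f (phi N)) = f (mexp S M phi).
Proof.
elim: M phi => //= M IH phi; rewrite IH linearD linearZ linear_sum.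
by congr (_ + _); apply: eq_bigr => j _; rewrite IH linearZ.
Qed.

Lemma mexpZ S M (c : R) phi :
  mexp S M (fun N => c *: phi N) = c *: mexp S M phi.
Proof. exact: (mexp_linear ( *:%R c)). Qed.

(* Exchangeability of the letters: N i is a sum of M + 1 indicators with the
   same distribution. *)
Lemma mexp_count S M phi (i : I) : i \in S ->
  mexp S M.+1 (fun N => (N i)%:R *: phi N) =
  (M.+1%:R * p i) *: mexp S M (fun N => phi (incr N i)).
Proof.
move=> iS; elim: M phi => [|M IH] phi.
  rewrite /= scale0r scaler0 add0r (bigD1 i) //= incr_id.
  rewrite scalerA mulrC big1 ?addr0 // => j /andP[_ ji].
  by rewrite incr_neq 1?eq_sym // scale0r scaler0.
have mexpS N psi : mexp S N.+1 psi = p0 *: mexp S N psi +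
  \sum_(j in S) p j *: mexp S N (fun N0 => psi (incr N0 j)) by [].
rewrite mexpS.
(* The first letter adds 1 to the count of [i] only when [j = i]. This splits off the mean over one
   letter fewer, and the remaining sum falls under the induction hypothesis. *)
have -> : \sum_(j in S) p j *: mexp S M.+1 (fun N => (incr N j i)%:R *: phi (incr N j))
  = \sum_(j in S) p j *: mexp S M.+1 (fun N => (N i)%:R *: phi (incr N j))
    + p i *: mexp S M.+1 (fun N => phi (incr N i)).
  rewrite (bigD1 i iS) [in RHS](bigD1 i iS) [in RHS]addrAC.
  congr (_ + _); last first.
    apply: eq_bigr => j /andP[_ ji]; congr (_ *: _); apply: mexp_ext => N.
    by rewrite incr_neq 1?eq_sym.
  rewrite -scalerDr -mexpD; congr (_ *: _); apply: mexp_ext => N.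
  by rewrite incr_id -natr1 scalerDl scale1r.
rewrite addrA IH.
under eq_bigr do rewrite IH.
have scC (b c : R) (v : V) : b *: (c *: v) = c *: (b *: v).
  by rewrite !scalerA mulrC.
rewrite scC.
have -> : \sum_(j in S) p j *: (M.+1%:R * p i *: mexp S M (fun N => phi (incr (incr N i) j)))
  = (M.+1%:R * p i) *: \sum_(j in S) p j *: mexp S M (fun N => phi (incr (incr N j) i)).
  rewrite scaler_sumr; apply: eq_bigr => j _.
  rewrite scC; congr (_ *: (_ *: _)); apply: mexp_ext => N.
  by rewrite incrC.
by rewrite -scalerDr -mexpS -[M.+2%:R]natr1 mulrDl mul1r scalerDl.
Qed.

(** Since the weights are not renormalised, deleting a letter from the alphabet amounts to
    restricting to the event that it is never drawn. *)
Lemma mexp_setD1 S M phi (i : I) : i \in S ->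
  mexp (S :\ i) M phi = mexp S M (fun N => (N i == 0%N)%:R *: phi N).
Proof.
move=> iS; elim: M phi => [|M IH] phi; first by rewrite /= scale1r.
rewrite /= IH (big_setD1 i iS) /=; congr (_ + _).
have -> : mexp S M (fun N => (incr N i i == 0%N)%:R *: phi (incr N i)) = 0.
  by rewrite -[RHS](mexp0 S M); apply: mexp_ext => N; rewrite incr_id scale0r.
rewrite scaler0 add0r; apply: eq_bigr => j; rewrite !inE => /andP[ji _].
by rewrite IH; congr (_ *: _); apply: mexp_ext => N; rewrite incr_neq // eq_sym.
Qed.

Lemma mexp_scale_vec S M (f : (I -> nat) -> R^o) (v : V) :
  mexp S M (fun N => f N *: v) = mexp S M f *: v.
Proof.
elim: M f => //= M IH f; rewrite IH scalerDl scalerA scaler_suml.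
by congr (_ + _); apply: eq_bigr => j _; rewrite IH scalerA.
Qed.

End Linear.

Lemma mexpMl (A : algType R) S M (x : A) (phi : (I -> nat) -> A) :
  mexp S M (fun N => x * phi N) = x * mexp S M phi.
Proof.
elim: M phi => //= M IH phi; rewrite IH mulrDr scalerAr mulr_sumr.
by congr (_ + _); apply: eq_bigr => j _; rewrite IH scalerAr.
Qed.

End Multinomial.


(** * Polynomials modulo a power of X, and the level recursion *)

Section TruncatedSeries.
Variable R : fieldType.
Implicit Types (p q : {poly R}).

(** Congruence of power series up to order L, written as divisibility so that coprime factors can be
    cancelled. *)
Definition eqX (L : nat) p q : bool := 'X^L %| p - q.

Lemma eqX_refl L p : eqX L p p.
Proof. by rewrite /eqX subrr dvdp0. Qed.

Lemma eqX_sym L p q : eqX L p q -> eqX L q p.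
Proof. by rewrite /eqX -opprB dvdpNr. Qed.

Lemma eqX_trans L q p s : eqX L p q -> eqX L q s -> eqX L p s.
Proof. by move=> pq qs; rewrite /eqX -(subrKA q p (- s)) dvdp_add. Qed.

Lemma eqXD L p q p' q' : eqX L p q -> eqX L p' q' -> eqX L (p + p') (q + q').
Proof. by move=> pq pq'; rewrite /eqX opprD addrACA dvdp_add. Qed.

Lemma eqX_sum L (J : Type) (s : seq J) (P : pred J) (f g : J -> {poly R}) :
  (forall k, P k -> eqX L (f k) (g k)) ->
  eqX L (\sum_(k <- s | P k) f k) (\sum_(k <- s | P k) g k).
Proof.
move=> fg; elim/big_ind2 : _ => //; first exact: eqX_refl.
by move=> *; exact: eqXD.
Qed.

Lemma eqXMl L s p q : eqX L p q -> eqX L (s * p) (s * q).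
Proof. by rewrite /eqX -mulrBr; exact: dvdp_mull. Qed.

Lemma eqXMr L s p q : eqX L p q -> eqX L (p * s) (q * s).
Proof. by rewrite ![_ * s]mulrC; exact: eqXMl. Qed.

Lemma eqX_mul L p q p' q' :
  eqX L p q -> eqX L p' q' -> eqX L (p * p') (q * q').
Proof. by move=> pq pq'; apply: eqX_trans (eqXMr _ pq) (eqXMl _ pq'). Qed.

Lemma eqXZ L c p q : eqX L p q -> eqX L (c *: p) (c *: q).
Proof. by rewrite -!mul_polyC; exact: eqXMl. Qed.

Lemma eqX_mulrn L n p q : eqX L p q -> eqX L (p *+ n) (q *+ n).
Proof. by rewrite -[p *+ n]mulr_natl -[q *+ n]mulr_natl; exact: eqXMl. Qed.

(** A factor X^k gains k orders of precision. This repays the order lost whenever the modulus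
    X^(|S|+1) shrinks with the set S. *)
Lemma eqX_shift L k p q : eqX L p q -> eqX (L + k) ('X^k * p) ('X^k * q).
Proof.
by move=> pq; rewrite /eqX -mulrBr addnC exprD dvdp_mul.
Qed.

Lemma eqX_leq L K p q : (L <= K)%N -> eqX K p q -> eqX L p q.
Proof. by move=> LK; apply: dvdp_trans; rewrite dvdp_exp2l. Qed.

Lemma eqX_coef L p q : eqX L p q -> forall i, (i < L)%N -> p`_i = q`_i.
Proof.
move=> /dvdpP[c pq] i iL; apply/eqP.
by rewrite -subr_eq0 -coefB pq coefMXn iL.
Qed.

Lemma coef_eqX L p q : (forall i, (i < L)%N -> p`_i = q`_i) -> eqX L p q.
Proof.
move=> pq; rewrite /eqX -[p - q](poly_take_drop L).
suff -> : take_poly L (p - q) = 0 by rewrite add0r dvdp_mull.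
apply/polyP => i; rewrite coef_take_poly coef0; case: ifP => // iL.
by rewrite coefB pq ?subrr.
Qed.

(** A polynomial with nonzero constant term is coprime to X^L. *)
Lemma eqX_cancel L c p q : c != 0 ->
  eqX L ((c%:P + 'X) * p) ((c%:P + 'X) * q) -> eqX L p q.
Proof.
move=> c0; rewrite /eqX -mulrBr Gauss_dvdpr //.
apply: coprimep_expl; rewrite addrC -[c]opprK polyCN coprimep_XsubC.
by rewrite rootX oppr_eq0.
Qed.

End TruncatedSeries.

Section NegativeBinomial.
Variable R : numFieldType.

(* The expansion of (n + X)^-k, truncated modulo X^L. *)
Definition negbin (L k n : nat) : {poly R} :=
  \poly_(l < L) ((-1) ^+ l * 'C(k + l - 1, l)%:R / n%:R ^+ (k + l)).

(** Truncated subtraction gives C(0, 0) = 1 at l = 0, while C(l - 1, l) = 0 for l > 0. *)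
Lemma negbin0 L n : (0 < L)%N -> negbin L 0 n = 1.
Proof.
move=> L0; apply/polyP => i; rewrite coef_poly coef1 add0n.
case: i => [|i] /=; first by rewrite L0 expr0 bin0 !mul1r invr1.
by rewrite subn1 bin_small // mulr0 mul0r if_same.
Qed.

(** Pascal's rule, read on coefficients. It is what makes the recursion in M first-order. *)
Lemma negbinS L k n : (0 < n)%N ->
  eqX L ((n%:R%:P + 'X) * negbin L k.+1 n) (negbin L k n).
Proof.
move=> n0; have nz : n%:R != 0 :> R by rewrite pnatr_eq0 -lt0n.
apply: coef_eqX => i iL; rewrite mulrDl coefD coefCM coefXM !coef_poly iL.
case: i iL => [|i] iL /=.
  by rewrite !addn0 !bin0 addr0 !mul1r exprS invfM mulVKf.
rewrite (ltnW iL) !addSn !subSS !subn0 !addnS !subSS subn0.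
rewrite binS natrD !exprS.
have := expf_neq0 (k + i) nz; move: (n%:R ^+ _) nz => y.
move: n%:R ((-1) ^+ i) ('C(_, _)%:R) ('C(_, _)%:R) => x e b c x0 y0.
by field; rewrite x0 y0.
Qed.

End NegativeBinomial.

Section ClosedForm.
Variables (R : numFieldType) (I : finType) (p0 : R) (p : I -> R) (L : nat).
Implicit Types (S U : {set I}) (M : nat) (h : I -> R).

Definition mass S : R := p0 + \sum_(i in S) p i.

(** Recursion on the top level: [S :\: U] is the set of indices sent to the level M, and [mass U] is
    the factor n = M - 1 of the telescoped product of the z_i^(n_i). At M = 0 everything lies in
    K_0, which contributes (r - t)!. *)
Fixpoint lev M S : {poly R} :=
  if M is M'.+1 then
    \sum_(U : {set I} | U \subset S)
      ('X^#|S :\: U| * negbin R L #|S :\: U| M * (mass U *: lev M' U))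
        *+ (#|S :\: U|)`!
  else ((#|S|)`!)%:R.

(** With h i = - H_{N_i} this is the random sum inside the expectation of the closed form. *)
Definition theta S h : {poly R} :=
  \sum_(A : {set I} | A \subset S)
    (\prod_(i in A) h i *: 'X^#|A|) *+ (#|S :\: A|)`!.

Definition harm n : R := \sum_(k < n) k.+1%:R^-1.

Definition gprod M : {poly R} := \prod_(k < M) (1 + k.+1%:R^-1 *: 'X).

(** Mark an element i of S \ U: n! is a sum of n copies of (n - 1)!, and n > 0 because U is proper.
    Both [lev] and [theta] owe their recursion over S to this identity. *)
Lemma sum_proper_fact (V : nmodType) (G : {set I} -> V) S :
  \sum_(U : {set I} | U \proper S) G U *+ (#|S :\: U|)`! =
  \sum_(i in S) \sum_(U : {set I} | U \subset S :\ i)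
     G U *+ (#|(S :\ i) :\: U|)`!.
Proof.
rewrite (exchange_big_dep (fun U : {set I} => U \proper S)) /=; last first.
  by move=> i U iS US; apply: sub_proper_trans US _; exact: finset.properD1.
apply: eq_bigr => U US; have sUS := proper_sub US.
have cardDi i : i \in S :\: U -> #|(S :\ i) :\: U| = #|S :\: U|.-1.
  move=> iSU; rewrite (cardsD1 i (S :\: U)) iSU add1n /=.
  by congr #|pred_of_set _|; rewrite !finset.setDDl finset.setUC.
have eqP i : (i \in S) && (U \subset S :\ i) = (i \in S :\: U).
  by rewrite inE andbC finset.subsetD1 sUS.
rewrite (eq_bigl _ _ eqP) (eq_bigr (fun=> G U *+ (#|S :\: U|.-1)`!)); last first.
  by move=> i /cardDi ->.
rewrite sumr_const -mulrnA; congr (_ *+ _).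
have : (0 < #|S :\: U|)%N by rewrite card_gt0 finset.setD_eq0; case/andP: US.
by case: #|S :\: U| => // n _; rewrite factS mulnC.
Qed.

Lemma subset_proper (V : nmodType) (G : {set I} -> V) S :
  \sum_(U : {set I} | U \subset S) G U =
  G S + \sum_(U : {set I} | U \proper S) G U.
Proof.
rewrite (bigD1 S) //=; congr (_ + _); apply: eq_bigl => U.
by rewrite finset.properEneq andbC.
Qed.

(** Marking an element handles every A except A = S. The leftover term has degree |S|, so one
    further factor X pushes it beyond the precision in use. *)
Lemma theta_rec S h :
  theta S h = \prod_(i in S) h i *: 'X^#|S| + \sum_(i in S) theta (S :\ i) h.
Proof. by rewrite /theta subset_proper finset.setDv finset.cards0 sum_proper_fact. Qed.

(** Isolate U = S, mark an index i of the top block in the other terms, and let M + 1 + X lower the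
    exponent of [negbin] by one. What remains is the same sum for S without i, times X. *)
Lemma lev_rec M S : (0 < L)%N ->
  eqX L ((M.+1%:R%:P + 'X) * lev M.+1 S)
    ((M.+1%:R%:P + 'X) * (mass S *: lev M S) + 'X * \sum_(i in S) lev M.+1 (S :\ i)).
Proof.
move=> L0; rewrite [lev M.+1 S]/= subset_proper finset.setDv finset.cards0.
rewrite expr0 mul1r negbin0 // mul1r mulr1n mulrDr.
apply: eqXD; first exact: eqX_refl.
rewrite [X in _ * X]sum_proper_fact !mulr_sumr; apply: eqX_sum => i iS.
rewrite !mulr_sumr; apply: eqX_sum => U US.
have -> : #|S :\: U| = #|(S :\ i) :\: U|.+1.
  rewrite (cardsD1 i) !inE iS.
  have /fintype.subsetP/(_ i)/contra -> := US; last by rewrite !inE eqxx.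
  by rewrite add1n; congr (#|pred_of_set _|.+1); rewrite !finset.setDDl finset.setUC.
set k := #|_|; rewrite !mulrnAr; apply: eqX_mulrn.
rewrite exprS !mulrA; apply: eqXMr.
rewrite [X in eqX _ X _](_ : _ = 'X * 'X^k * ((M.+1%:R%:P + 'X) * negbin R L k.+1 M.+1)).
  exact/eqXMl/negbinS.
by ring.
Qed.

(** [theta] is affine in each h i. The slope comes from the sets A containing i, and removing i from
    both A and S leaves S \ A unchanged. *)
Lemma theta_shift1 S h h' i : i \in S -> (forall j, j != i -> h' j = h j) ->
  theta S h' = theta S h + (h' i - h i) *: ('X * theta (S :\ i) h).
Proof.
move=> iS hh'; apply/eqP; rewrite addrC -subr_eq; apply/eqP.
rewrite /theta -sumrB (bigID (fun A : {set I} => i \in A)) /=.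
rewrite [X in _ + X]big1 ?addr0; last first.
  move=> A /andP[_ iA]; rewrite (eq_bigr h) ?subrr // => j jA.
  by rewrite hh' //; apply: contraNneq iA => <-.
rewrite (reindex_onto (fun B => i |: B) (fun A => A :\ i)) /=; last first.
  by move=> A /andP[_ iA]; rewrite finset.setD1K.
rewrite mulr_sumr scaler_sumr; apply: eq_big => [B|B].
  rewrite finset.setU11 andbT finset.subUset finset.sub1set iS /= finset.subsetD1; congr (_ && _).
  apply/eqP/idP => [<-|]; first by rewrite !inE eqxx.
  exact: finset.setU1K.
move=> /andP[/andP[_ _] /eqP iB].
have niB : i \notin B by rewrite -iB !inE eqxx.
rewrite !finset.big_setU1 //= (eq_bigr h); last first.
  by move=> j jB; rewrite hh' //; apply: contraNneq niB => <-.
rewrite -mulrnBl -scalerBl -mulrBl finset.setDDl finset.cardsU1 niB mulrnAr scalerMnr.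
by rewrite -scalerA -scalerAr scalerMnr exprS.
Qed.

Lemma theta_ext S h h' : {in S, h =1 h'} -> theta S h = theta S h'.
Proof.
move=> hh'; apply: eq_bigr => A /fintype.subsetP AS; congr (_ *: _ *+ _).
by apply: eq_bigr => i /AS /hh'.
Qed.

Lemma harmS n : harm n.+1 = harm n + n.+1%:R^-1.
Proof. by rewrite /harm big_ord_recr. Qed.

Definition mtheta M S : {poly R} :=
  mexp p0 p S M (fun N => theta S (fun i => - harm (N i))).

(** The means [Y] below enter twice: with a minus sign when the first letter is split off, and with
    a plus sign when X times [mtheta] is expanded by [theta_rec]. Multiplication by M + 1 + X makes
    them cancel. *)
Lemma mtheta_rec M S :
  eqX #|S|.+1 ((M.+1%:R%:P + 'X) * mtheta M.+1 S)
    (M.+1%:R%:P * (mass S *: mtheta M S) + 'X * \sum_(i in S) mtheta M.+1 (S :\ i)).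
Proof.
pose h (N : I -> nat) i := - harm (N i).
(* A draw of i changes - H_{N_i} by - 1 / (N_i + 1), which by [theta_shift1] changes [theta] by this
   integrand with a minus sign. *)
pose Y i := mexp p0 p S M (fun N => (N i).+1%:R^-1 *: ('X * theta (S :\ i) (h N))).
have first_letter : mtheta M.+1 S = mass S *: mtheta M S - \sum_(i in S) p i *: Y i.
  rewrite /mtheta /= /mass scalerDl -addrA; congr (_ + _).
  rewrite scaler_suml -sumrB; apply: eq_bigr => i iS.
  rewrite -scalerBr; congr (_ *: _).
  rewrite -[in RHS]scaleN1r -mexpZ -mexpD; apply: mexp_ext => N.
  rewrite (@theta_shift1 S (h N) _ i iS) => [|j ji]; last by rewrite incr_neq.
  by rewrite incr_id /h harmS opprD addrAC subrr add0r scaleN1r scaleNr.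
(* Write 1 = [N_i = 0] + N_i (1 / N_i). The first part deletes the letter i by [mexp_setD1], and the
   second is evaluated by [mexp_count]. *)
have drop_letter i : i \in S ->
    mexp p0 p S M.+1 (fun N => 'X * theta (S :\ i) (h N)) =
    'X * mtheta M.+1 (S :\ i) + (M.+1%:R * p i) *: Y i.
  move=> iS; rewrite /mtheta mexp_setD1 //.
  have -> : Y i = mexp p0 p S M (fun N => (incr N i i)%:R^-1 *: ('X * theta (S :\ i) (h (incr N i)))).
    apply: mexp_ext => N; rewrite incr_id; congr (_ *: (_ * _)).
    by apply: theta_ext => j; rewrite !inE /h => /andP[ji _]; rewrite incr_neq.
  rewrite -(mexp_count _ _ _ (fun N => (N i)%:R^-1 *: ('X * theta (S :\ i) (h N)))) //.
  rewrite -mexpMl.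
  rewrite -mexpD; apply: mexp_ext => N; rewrite -scalerAr scalerA -scalerDl.
  case: (N i) => [|n]; first by rewrite eqxx mul0r addr0 scale1r.
  by rewrite add0r divff ?pnatr_eq0 // scale1r.
have peel : 'X * mtheta M.+1 S =
    'X^(#|S|.+1) * (mexp p0 p S M.+1 (fun N => \prod_(i in S) h N i : R^o))%:P
    + \sum_(i in S) ('X * mtheta M.+1 (S :\ i) + (M.+1%:R * p i) *: Y i).
  rewrite -mexpMl.
  under eq_bigr => i iS do rewrite -drop_letter //.
  rewrite -mexp_sum.
  have -> : 'X^(#|S|.+1) * (mexp p0 p S M.+1 (fun N => \prod_(i in S) h N i : R^o))%:P
      = mexp p0 p S M.+1 (fun N => (\prod_(i in S) h N i) *: 'X^(#|S|.+1)).
    by rewrite mulrC mul_polyC mexp_scale_vec.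
  rewrite -mexpD; apply: mexp_ext => N.
  by rewrite theta_rec mulrDr mulr_sumr -scalerAr exprS.
move: peel; set c := mexp _ _ _ _ _ => peel.
rewrite /eqX mulrDl peel first_letter big_split /= mulr_sumr mulrBr mulr_sumr.
rewrite [X in _ %| X](_ : _ = 'X^(#|S|.+1) * c%:P) ?dvdp_mulIl //.
have -> : \sum_(i in S) M.+1%:R%:P * (p i *: Y i) = \sum_(i in S) (M.+1%:R * p i) *: Y i.
  by apply: eq_bigr => i _; rewrite mul_polyC scalerA.
by ring.
Qed.

Lemma gprodS M : M.+1%:R%:P * gprod M.+1 = (M.+1%:R%:P + 'X) * gprod M.
Proof.
rewrite /gprod big_ord_recr /= mulrCA mulrDr mulr1 mul_polyC scalerA.
by rewrite divff ?pnatr_eq0 // scale1r mulrC.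
Qed.

(** Both sides satisfy the same recursion, [gprodS] absorbing the factor M + 1 + X on the right. The
    induction is on M and, inside, on |S|, because the recursion refers to M + 1 at smaller sets. *)
Lemma lev_closed M S : (#|S| < L)%N -> eqX #|S|.+1 (lev M S) (gprod M * mtheta M S).
Proof.
elim: M S => [|M IHM] S.
  (* Since H_0 = 0, only the empty A survives at M = 0. *)
  move=> _; rewrite /gprod big_ord0 mul1r /mtheta /= /theta.
  rewrite (bigD1 finset.set0) ?finset.sub0set //= finset.big_set0 finset.cards0 finset.setD0 scale1r big1 ?addr0.
    exact: eqX_refl.
  move=> A /andP[_ /finset.set0Pn[i iA]]; rewrite (bigD1 i) //= /harm big_ord0.
  by rewrite oppr0 mul0r scale0r mul0rn.
have [n] := ubnP #|S|; elim: n S => // n IHn S Sn SL.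
have M0 : M.+1%:R != 0 :> R by rewrite pnatr_eq0.
apply: (eqX_cancel M0).
apply: (eqX_trans (eqX_leq SL (lev_rec M S _))).
  exact: leq_ltn_trans SL.
rewrite mulrCA; apply: eqX_sym.
apply: (eqX_trans (eqXMl _ (mtheta_rec M S))).
rewrite mulrDr mulrCA mulrA gprodS.
apply: eqXD.
  rewrite -mulrA -scalerAr; apply: eqXMl; apply: eqXZ; apply: eqX_sym; exact: IHM.
rewrite mulrCA !mulr_sumr; apply: eqX_sum => i iS.
have cS : #|S| = #|S :\ i|.+1 by rewrite (cardsD1 i) iS.
(* The hypothesis for S without i holds only modulo X^|S|; the factor X in front restores the
   missing order. *)
rewrite [in X in eqX X]cS -addn1 -['X]expr1; apply: eqX_shift; apply: eqX_sym; apply: IHn.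
  by rewrite -ltnS -cS.
by rewrite -cS ltnW.
Qed.

End ClosedForm.


(** * Exponential shift and Bell polynomials *)

Section ExponentialShift.
Variables (R : numFieldType) (I : finType).
Implicit Types (S A B : {set I}) (h : I -> R).

Definition expX (L : nat) (c : R) : {poly R} := \poly_(k < L) (c ^+ k / k`!%:R).

Lemma prod_addr_const A h c :
  \prod_(i in A) (h i + c) =
  \sum_(B : {set I} | B \subset A) \prod_(i in B) h i * c ^+ #|A :\: B|.
Proof.
rewrite big_mkcond /= (eq_bigr (fun i => (if i \in A then h i else 0) +
  (if i \in A then c else 1))); last by move=> i _; case: ifP; rewrite ?add0r.
rewrite bigA_distr (bigID (fun B => B \subset A)) /= [X in _ + X]big1 ?addr0.
  apply: eq_bigr => B BA; rewrite (bigID (mem B)) /=; congr (_ * _).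
    apply: eq_bigr => i iB; rewrite iB.
    by move/fintype.subsetP : BA => ->.
  rewrite -prodr_const [RHS]big_mkcond [LHS]big_mkcond.
  by apply: eq_bigr => i _; rewrite !inE; case: (i \in B).
move=> B /fintype.subsetPn[i iB iA].
by rewrite (bigD1 i) //= iB (negPf iA) mul0r.
Qed.

Lemma sum_subset_card (V : nmodType) S (f : nat -> V) :
  \sum_(A : {set I} | A \subset S) f #|A| = \sum_(k < #|S|.+1) f k *+ 'C(#|S|, k).
Proof.
rewrite (partition_big (fun A => inord #|A| : 'I_#|S|.+1) predT) //=.
apply: eq_bigr => k _; rewrite -cards_draws -sumr_const.
apply: eq_big => [A|A].
  rewrite inE; apply: andb_id2l => AS.
  by rewrite -val_eqE /= inordK // ltnS subset_leq_card.
move=> /andP[AS /eqP <-]; rewrite inordK // ltnS subset_leq_card //.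
Qed.

(** Expand the shifted products and set A = B + T with T disjoint from B. With n = |S \ B|, the sum
    over T is n! times the exponential series of cX cut after degree n, because C(n, k) (n - k)! =
    n! / k!. *)
Lemma theta_exp L S h c : (#|S| < L)%N ->
  eqX #|S|.+1 (theta S (fun i => h i + c)) (expX L c * theta S h).
Proof.
move=> SL.
have -> : theta S (fun i => h i + c) = \sum_(B : {set I} | B \subset S)
    'X^#|B| * (\prod_(i in B) h i *:
       \sum_(T : {set I} | T \subset S :\: B)
          ((c *: 'X) ^+ #|T| *+ (#|S :\: B| - #|T|)`!)).
  rewrite /theta.
  under eq_bigr => A _ do rewrite prod_addr_const scaler_suml -sumrMnl.
  rewrite (exchange_big_dep (fun B => B \subset S)) /=; last first.
    by move=> A B AS BA; exact: fintype.subset_trans AS.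
  apply: eq_bigr => B BS; rewrite scaler_sumr mulr_sumr.
  rewrite (reindex_onto (fun T => B :|: T) (fun A => A :\: B)) /=; last first.
    by move=> A /andP[AS BA]; rewrite finset.setUC finset.setDE finset.setUIl
       [~: B :|: B]finset.setUC finset.setUCr finset.setIT; apply/finset.setUidPl.
  apply: eq_big => [T|T].
    rewrite finset.subUset BS finset.subsetUl andbT /= finset.subsetD; congr (_ && _).
    rewrite finset.setDUl finset.setDv finset.set0U.
    by apply/eqP/idP => /finset.setDidPl.
  rewrite finset.setDUl finset.setDv finset.set0U => /andP[/andP[TS BT] /eqP TB].
  have TD : T \subset S :\: B.
    rewrite finset.subsetD; apply/andP; split; last exact/finset.setDidPl.
    by move: TS; rewrite finset.subUset => /andP[].
  have cBT : #|B :|: T| = (#|B| + #|T|)%N.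
    rewrite finset.cardsU (_ : B :&: T = finset.set0) ?finset.cards0 ?subn0 //.
    by apply/finset.disjoint_setI0; rewrite disjoint_sym; apply/finset.setDidPl.
  rewrite TB cBT -finset.setDDl finset.cardsD (finset.setIidPr TD).
  rewrite -scalerAr -scalerA scalerMnr; congr (_ *: _).
  by rewrite exprZn exprD mulrnAr -scalerAr.
rewrite /theta mulr_sumr; apply: eqX_sum => B BS.
have cS : #|S|.+1 = (#|S :\: B|.+1 + #|B|)%N.
  by rewrite addSn finset.cardsD (finset.setIidPr BS) subnK // subset_leq_card.
rewrite (sum_subset_card _ (fun k => (c *: 'X) ^+ k *+ (#|S :\: B| - k)`!)).
have -> : expX L c * (\prod_(i in B) h i *: 'X^#|B| *+ (#|S :\: B|)`!) =
    'X^#|B| * (\prod_(i in B) h i *: (expX L c *+ (#|S :\: B|)`!)).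
  by rewrite mulrnAr -!scalerAr mulrnAr [expX L c * _]mulrC scalerMnr.
(* The cut after degree |S \ B| is harmless, since X^|B| stands in front. *)
rewrite cS; apply: eqX_shift; apply: eqXZ.
have nL : (#|S :\: B| < L)%N by apply: leq_ltn_trans SL; apply/subset_leq_card/subsetDl.
move: (#|S :\: B|) nL => n nL.
have -> : \sum_(k < n.+1) (c *: 'X) ^+ k *+ (n - k)`! *+ 'C(n, k) =
    \poly_(k < n.+1) (c ^+ k *+ ((n - k)`! * 'C(n, k))) :> {poly R}.
  rewrite poly_def; apply: eq_bigr => k _.
  by rewrite exprZn -mulrnA -!scalerMnl.
apply: coef_eqX => i iN; rewrite coef_poly iN coefMn coef_poly (leq_trans iN nL).
rewrite -[RHS]mulr_natr -[LHS]mulr_natr -(@bin_fact n i) // !natrM.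
have : (i`!)%:R != 0 :> R by rewrite pnatr_eq0 -lt0n fact_gt0.
by move=> i0; field.
Qed.

Lemma eqX_mexp p0 (p : I -> R) S M (n : nat) (phi psi : (I -> nat) -> {poly R}) :
  (forall N, eqX n (phi N) (psi N)) ->
  eqX n (mexp p0 p S M phi) (mexp p0 p S M psi).
Proof.
elim: M phi psi => [|M IH] phi psi pp; first exact: pp.
apply: eqXD; first exact/eqXZ/IH.
by apply: eqX_sum => j _; apply/eqXZ/IH => N; exact: pp.
Qed.

(** In characteristic 0 the equation f' = xi f determines the coefficients successively from the
    constant term. *)
Lemma eqX_logderiv L (xi f g : {poly R}) : f`_0 = g`_0 ->
  eqX L f^`() (xi * f) -> eqX L g^`() (xi * g) -> eqX L.+1 f g.
Proof.
move=> fg0 Df Dg; apply: coef_eqX => i; have [n] := ubnP i.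
elim: n i => // n IH [|i] //; rewrite !ltnS => iN iL.
have /eqX_coef/(_ _ iL) := Df; have /eqX_coef/(_ _ iL) := Dg.
rewrite !coef_deriv !coefM => gE fE.
have i0 : i.+1%:R != 0 :> R by rewrite pnatr_eq0.
apply: (mulIf i0); rewrite !mulr_natr fE gE.
apply: eq_bigr => j _; congr (_ * _); apply: IH.
  exact: leq_ltn_trans (leq_subr _ _) iN.
exact: leq_ltn_trans (leq_subr _ _) (leqW iL).
Qed.

End ExponentialShift.

(** * Generating function of the Bell polynomials at truncated zeta values *)

Section Bell.
Variable R : realType.

Definition bellX (L : nat) (x : nat -> R) : {poly R} :=
  \poly_(k < L) (bell x k / k`!%:R).

Lemma bellS (x : nat -> R) n :
  bell x n.+1 = \sum_(s < n.+1) 'C(n, s)%:R * x s.+1 * bell x (n - s).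
Proof. by []. Qed.

(** The defining recursion of the Bell polynomials is this differential equation read
    coefficientwise. *)
Lemma deriv_bellX L (x : nat -> R) :
  eqX L (bellX L.+1 x)^`() (\poly_(s < L) (x s.+1 / s`!%:R) * bellX L.+1 x).
Proof.
have f0 n : (n`!)%:R != 0 :> R by rewrite pnatr_eq0 -lt0n fact_gt0.
apply: coef_eqX => i iL; rewrite coef_deriv coefM coef_poly ltnS iL.
rewrite bellS; set b := \sum_(s < _) _.
have -> : b / (i.+1)`!%:R *+ i.+1 = b / i`!%:R.
  have i0 : i.+1%:R != 0 :> R by rewrite pnatr_eq0.
  by rewrite -mulr_natr factS natrM; field; rewrite f0 nat1r.
rewrite {}/b.
rewrite mulr_suml; apply: eq_bigr => s _.
have si : (s <= i)%N by rewrite -ltnS.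
rewrite !coef_poly (leq_ltn_trans si iL) ltnS (leq_trans (leq_subr _ _) (ltnW iL)).
rewrite -(bin_fact si) !natrM.
have := f0 s; have := f0 (i - s)%N; have : 'C(i, s)%:R != 0 :> R.
  by rewrite pnatr_eq0 -lt0n bin_gt0.
by move=> *; field; apply/and3P.
Qed.

Definition zeta_arg_trunc (M j : nat) : R :=
  if (j <= 1)%N then 0
  else (-1) ^+ j.-1 * (j.-1)`!%:R * \sum_(k < M) (k.+1%:R ^+ j)^-1.

(** Both sides have constant term 1, so by [eqX_logderiv] it is enough that their logarithmic
    derivatives agree. *)
Lemma gprod_exp_bell L M :
  eqX L.+1 (gprod R M * expX L.+1 (- harm R M)) (bellX L.+1 (zeta_arg_trunc M)).
Proof.
apply: (@eqX_logderiv _ _ (\poly_(s < L) (zeta_arg_trunc M s.+1 / s`!%:R))) => //.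
- rewrite coef0M !coef_poly /= expr0; suff -> : (gprod R M)`_0 = 1 by rewrite mul1r.
  rewrite /gprod -horner_coef0 horner_prod big1 // => k _.
  by rewrite !hornerE.
- have DE : eqX L (expX L.+1 (- harm R M))^`() ((- harm R M)%:P * expX L.+1 (- harm R M)).
    apply: coef_eqX => i iL.
    rewrite coef_deriv coefCM !coef_poly ltnS iL ltnW // factS natrM invfM -mulr_natr exprS.
    have i0 : (i`!)%:R != 0 :> R by rewrite pnatr_eq0 -lt0n fact_gt0.
    have i1 : i.+1%:R != 0 :> R by rewrite pnatr_eq0.
    by field; rewrite nat1r i0 i1.
  (* The logarithmic derivative of the product of the 1 + X/k is the sum of the 1 / (k + X),
     expanded by [negbin] with exponent 1. *)
  have DP : eqX L (gprod R M)^`() ((\sum_(k < M) negbin R L 1 k.+1) * gprod R M).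
    elim: M {DE} => [|M IH]; first by rewrite /gprod !big_ord0 derivC mul0r eqX_refl.
    have -> : gprod R M.+1 = gprod R M * (1 + M.+1%:R^-1 *: 'X).
      by rewrite /gprod big_ord_recr.
    rewrite derivM derivD derivZ derivX derivC add0r.
    rewrite big_ord_recr /= mulrDl; apply: eqXD.
      rewrite mulrA; exact/eqXMr/IH.
    have n0 : M.+1%:R != 0 :> R by rewrite pnatr_eq0.
    have -> : 1 + M.+1%:R^-1 *: 'X = M.+1%:R^-1 *: (M.+1%:R%:P + 'X) :> {poly R}.
      by rewrite scalerDr -[_%:P in RHS]alg_polyC scalerA mulVf // scale1r.
    rewrite -!scalerAr mulr1; apply: eqXZ.
    rewrite mulrCA mulrC [negbin _ _ _ _ * _]mulrC.
    rewrite -[X in eqX _ X _]mul1r; apply/eqXMr/eqX_sym.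
    have [->|L0] := posnP L; first by rewrite /eqX expr0 dvd1p.
    by rewrite -(@negbin0 R L M.+1) //; exact: negbinS.
  (* The constant term of the sum is H_M, which the exponential cancels; hence the first Bell
     argument 0. The higher coefficients are signed truncated zeta values. *)
  have xiE : eqX L (\poly_(s < L) (zeta_arg_trunc M s.+1 / s`!%:R))
      (\sum_(k < M) negbin R L 1 k.+1 + (- harm R M)%:P).
    apply: coef_eqX => i iL; rewrite coefD coefC coef_poly iL coef_sum.
    under eq_bigr => k _ do rewrite coef_poly iL addnC addn1 subn1 /= binn mulr1.
    case: i iL => [|i] iL /=.
      rewrite /zeta_arg_trunc /= mul0r /harm.
      by under eq_bigr do rewrite expr0 mul1r expr1; rewrite subrr.
    rewrite addr0 /zeta_arg_trunc /= mulrAC mulfK; last first.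
      by rewrite pnatr_eq0 -lt0n fact_gt0.
    by rewrite mulr_sumr.
  rewrite derivM.
  apply: eqX_trans (eqXMr _ (eqX_sym xiE)).
  rewrite mulrDl mulrA [(- harm R M)%:P * _]mulrCA; apply: eqXD; first exact: eqXMr.
  exact: eqXMl.
exact: deriv_bellX.
Qed.

End Bell.

(** * Coefficients of the closed form *)

Section LevCoefficient.
Variables (R : realType) (I : finType) (p0 : R) (p : I -> R).
Implicit Types (S A : {set I}).

Lemma coef_mexp S M (phi : (I -> nat) -> {poly R}) j :
  (mexp p0 p S M phi)`_j = mexp p0 p S M (fun N => (phi N)`_j : R^o).
Proof.
elim: M phi => //= M IH phi; rewrite coefD coefZ coef_sum IH; congr (_ + _).
by apply: eq_bigr => i _; rewrite coefZ IH.
Qed.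

Lemma coef_theta S (h : I -> R) j :
  (theta S h)`_j = (\sum_(A : {set I} | (A \subset S) && (#|A| == j)) \prod_(i in A) h i)
    *+ (#|S| - j)`!.
Proof.
rewrite coef_sum (bigID (fun A : {set I} => #|A| == j)) /= addrC big1 ?add0r.
  rewrite -sumrMnl; apply: eq_bigr => A /andP[AS /eqP <-].
  by rewrite coefMn coefZ coefXn eqxx mulr1 finset.cardsD (finset.setIidPr AS).
move=> A /andP[_ /negPf Aj].
by rewrite coefMn coefZ coefXn eq_sym Aj mulr0 mul0rn.
Qed.

(** Mean of the j-th elementary symmetric polynomial in the variables H_M - H_{N_i}. *)
Definition harm_moment M S j : R :=
  mexp p0 p S M (fun N => \sum_(A : {set I} | (A \subset S) && (#|A| == j))
    \prod_(i in A) (harm R M - harm R (N i)) : R^o).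

Lemma coef_lev L M S m : (m <= #|S|)%N -> (#|S| < L)%N ->
  (lev p0 p L M S)`_m = \sum_(k < m.+1)
    bell (zeta_arg_trunc R M) k / k`!%:R * (harm_moment M S (m - k)%N *+ (#|S| - (m - k))`!).
Proof.
move=> mS SL.
have H : eqX #|S|.+1 (lev p0 p L M S) (bellX L (zeta_arg_trunc R M) *
    mexp p0 p S M (fun N => theta S (fun i => harm R M - harm R (N i)))).
  apply: (eqX_trans (lev_closed _ _ _ SL)).
  (* By [theta_exp] with c = - H_M, passing from - H_{N_i} to H_M - H_{N_i} costs exactly the
     exponential that [gprod_exp_bell] needs. *)
  have E : eqX #|S|.+1 (mtheta p0 p M S) (expX L (- harm R M) *
      mexp p0 p S M (fun N => theta S (fun i => harm R M - harm R (N i)))).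
    rewrite -mexpMl; apply: eqX_mexp => N.
    apply: eqX_trans (theta_exp _ _ SL).
    rewrite (@theta_ext _ _ S _ (fun i => harm R M - harm R (N i) + - harm R M)).
      exact: eqX_refl.
    by move=> i _ /=; rewrite addrC addKr.
  apply: (eqX_trans (eqXMl _ E)); rewrite mulrA; apply: eqXMr.
  case: L SL {E} => // L SL; exact: (eqX_leq SL (gprod_exp_bell _ _ _)).
rewrite (eqX_coef H) ?ltnS // coefM; apply: eq_bigr => k _.
have kL : (k < L)%N by rewrite (leq_trans _ SL) // ltnS (leq_trans _ mS) // -ltnS.
rewrite coef_poly kL. congr (_ * _).
rewrite coef_mexp /harm_moment -[RHS]scaler_nat -mexpZ; apply: mexp_ext => N.
by rewrite coef_theta -scaler_nat.
Qed.

End LevCoefficient.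

(** * Comparison of harmonic numbers with logarithms *)

Section HarmonicEstimates.
Variable R : realType.
Implicit Types a b : R.

Lemma ln_sub_le a b : 0 < a -> 0 < b -> ln a - ln b <= (a - b) / b.
Proof.
move=> a0 b0; rewrite -ln_div ?posrE // mulrBl divff ?gt_eqF //.
by rewrite -{1}[a / b](subrK 1) addrC le_ln1Dx // ltrBrDr addrC subrr divr_gt0.
Qed.

(** The slope of ln between a and b is at most the larger of 1/a and 1/b. Their sum is used instead
    because its two terms can be averaged separately. *)
Lemma ln_dist_le a b : 0 < a -> 0 < b ->
  `|ln a - ln b| <= `|a - b| * (a^-1 + b^-1).
Proof.
move=> a0 b0; rewrite ler_norml -lerN2 opprB opprK mulrDr; apply/andP; split.
  apply: (le_trans (ln_sub_le b0 a0)); rewrite -[leLHS]addr0 lerD //.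
    by rewrite ler_pM2r ?invr_gt0 // distrC ler_norm.
  by rewrite mulr_ge0 // invr_ge0 ltW.
apply: (le_trans (ln_sub_le a0 b0)); rewrite -[leLHS]add0r lerD //.
  by rewrite mulr_ge0 // invr_ge0 ltW.
by rewrite ler_pM2r ?invr_gt0 // ler_norm.
Qed.

Lemma harm_le m n : (m <= n)%N -> harm R m <= harm R n.
Proof.
elim: n => [|n IH]; first by rewrite leqn0 => /eqP ->.
rewrite leq_eqVlt => /predU1P[->//|/IH mn].
by rewrite harmS (le_trans mn) // lerDl invr_ge0.
Qed.

Lemma harm_sub_ln m n : (m <= n)%N ->
  0 <= harm R n - harm R m - (ln n.+1%:R - ln m.+1%:R) <= m.+1%:R^-1.
Proof.
move=> mn.
(* The bound is sharpened to a telescoping one, so that induction on n only compares one increment: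
   1/(n+2) <= ln(n+2) - ln(n+1) <= 1/(n+1). *)
suff /andP[H1 H2] : 0 <= harm R n - harm R m - (ln n.+1%:R - ln m.+1%:R)
    <= m.+1%:R^-1 - n.+1%:R^-1.
  by rewrite H1 (le_trans H2) // gerBl invr_ge0.
elim: n mn => [|n IH]; first by rewrite leqn0 => /eqP ->; rewrite !subrr lexx.
rewrite leq_eqVlt => /predU1P[->|]; first by rewrite !subrr lexx.
rewrite ltnS => /IH /andP[H1 H2]; rewrite harmS.
have p1 : 0 < n.+1%:R :> R by [].
have p2 : 0 < n.+2%:R :> R by [].
have := ln_sub_le p2 p1; have := ln_sub_le p1 p2.
rewrite -[n.+2%:R]natr1.
have -> : (n.+1%:R - (n.+1%:R + 1)) / (n.+1%:R + 1) = - (n.+1%:R + 1)^-1 :> R.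
  by rewrite opprD addrA subrr add0r mulN1r.
rewrite [_ + 1 - _]addrAC subrr add0r mul1r => h1 h2.
move: H1 H2 h1 h2; move: (ln (n.+1%:R + 1)) (ln n.+1%:R) (ln m.+1%:R).
move: (n.+1%:R + 1)^-1 (n.+1%:R^-1) (m.+1%:R^-1) (harm R n) (harm R m).
by move=> u v w x y a b c *; apply/andP; split; lra.
Qed.

Lemma harm_le_ln n : harm R n <= ln n.+1%:R + 1.
Proof.
have /andP[_] := harm_sub_ln (leq0n n).
have -> : harm R 0 = 0 by rewrite /harm big_ord0.
by rewrite ln1 !subr0 invr1 lerBlDr addrC.
Qed.

Lemma harm_dev_le (q : R) (m n : nat) : (m <= n)%N -> 0 < q ->
  `|harm R n - harm R m - - ln q| <=
  m.+1%:R^-1 + `|m.+1%:R - n.+1%:R * q| * ((n.+1%:R * q)^-1 + m.+1%:R^-1).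
Proof.
move=> mn q0; have nq0 : 0 < n.+1%:R * q by rewrite mulr_gt0.
have -> : harm R n - harm R m - - ln q =
    (harm R n - harm R m - (ln n.+1%:R - ln m.+1%:R)) + (ln (n.+1%:R * q) - ln m.+1%:R).
  by rewrite lnM ?posrE //; ring.
apply: (le_trans (ler_normD _ _)); apply: lerD.
  by have /andP[H1 H2] := harm_sub_ln mn; rewrite ger0_norm.
by rewrite [X in _ <= X * _]distrC ln_dist_le.
Qed.

(** Exchange the factors one at a time. As K >= 1, the power K^|A| dominates every product of the
    remaining factors. *)
Lemma prod_dist_le (J : finType) (A : {set J}) (f g : J -> R) (K : R) : 1 <= K ->
  (forall j, j \in A -> `|f j| <= K) -> (forall j, j \in A -> `|g j| <= K) ->
  `|\prod_(j in A) f j - \prod_(j in A) g j| <=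
  K ^+ #|A| * \sum_(j in A) `|f j - g j|.
Proof.
move=> K1; have K0 : 0 <= K by exact: le_trans K1.
have [n] := ubnP #|A|; elim: n A => // n IH A An fK gK.
have [->|[j jA]] := finset.set_0Vmem A; first by rewrite !finset.big_set0 subrr normr0 mulr0.
have cA : #|A| = #|A :\ j|.+1 by rewrite (cardsD1 j) jA.
rewrite !(finset.big_setD1 j jA) /= cA.
set F := \prod_(i in A :\ j) f i; set G := \prod_(i in A :\ j) g i.
have IHA : `|F - G| <= K ^+ #|A :\ j| * \sum_(i in A :\ j) `|f i - g i|.
  by apply: IH => [|i|i]; rewrite ?inE; [rewrite -ltnS -cA|move=> /andP[_] /fK|move=> /andP[_] /gK].
have FK : `|F| <= K ^+ #|A :\ j|.
  rewrite /F normr_prod -prodr_const; apply: ler_prod => i.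
  by rewrite inE => /andP[_ /fK ->]; rewrite normr_ge0.
have -> : f j * F - g j * G = (f j - g j) * F + g j * (F - G) by ring.
apply: (le_trans (ler_normD _ _)); rewrite !normrM exprS mulrDr.
apply: lerD.
  rewrite mulrC ler_wpM2r //; apply: (le_trans FK).
  by rewrite ler_peMl // exprn_ge0.
by rewrite -mulrA; apply: ler_pM => //; exact: gK.
Qed.

End HarmonicEstimates.

(** * Law of large numbers for harmonic numbers *)

Section LawOfLargeNumbers.
Variables (R : realType) (I : finType) (p0 : R) (p : I -> R) (S : {set I}).
Hypotheses (p0_ge0 : 0 <= p0) (p_gt0 : forall i, i \in S -> 0 < p i).
Hypothesis mass1 : mass p0 p S = 1.

Let Ex (M : nat) (f : (I -> nat) -> R) : R := mexp p0 p S M (f : _ -> R^o).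

(** The inequality is only asked for counts at most M, the ones that M draws can produce; on these
    H_M - H_{N_i} is nonnegative and [harm_dev_le] applies. *)
Lemma mexp_le M (f g : (I -> nat) -> R) :
  (forall N, (forall i, (N i <= M)%N) -> f N <= g N) -> Ex M f <= Ex M g.
Proof.
rewrite /Ex; elim: M f g => [|M IH] f g fg /=; first exact: fg.
apply: lerD.
  by apply: ler_wpM2l => //; apply: IH => N NM; apply: fg => i; rewrite leqW.
apply: ler_sum => j jS; apply: ler_wpM2l; first exact/ltW/p_gt0.
apply: IH => N NM; apply: fg => i; rewrite /incr.
by rewrite -addn1 leq_add // leq_b1.
Qed.

Lemma mexp_const M (c : R) : Ex M (fun=> c) = c.
Proof.
rewrite /Ex; elim: M => //= M ->.
by rewrite -scaler_suml -scalerDl -/(mass p0 p S) mass1 scale1r.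
Qed.

Lemma weight_le1 i : i \in S -> p i <= 1.
Proof.
move=> iS; rewrite -mass1 /mass (bigD1 i) //= addrCA lerDl addr_ge0 // sumr_ge0 //.
by move=> j /andP[/p_gt0/ltW].
Qed.

Let ExD M f g : Ex M (fun N => f N + g N) = Ex M f + Ex M g.
Proof. exact: mexpD. Qed.

Let ExZ M c f : Ex M (fun N => c * f N) = c * Ex M f.
Proof. exact: mexpZ. Qed.

Let Ex_count M f i : i \in S -> Ex M.+1 (fun N => (N i)%:R * f N) =
  M.+1%:R * p i * Ex M (fun N => f (incr N i)).
Proof. by move=> iS; rewrite /Ex; exact: (mexp_count _ _ _ (f : _ -> R^o)). Qed.

Lemma mexp_mean M i : i \in S -> Ex M (fun N => (N i)%:R) = M%:R * p i.
Proof.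
move=> iS; case: M => [|M]; first by rewrite /Ex /= mul0r.
transitivity (Ex M.+1 (fun N => (N i)%:R * 1)).
  by apply: mexp_ext => N; rewrite mulr1.
by rewrite (Ex_count M (fun=> 1) iS) mexp_const mulr1.
Qed.

(** Exchangeability reduces the second moment of N_i over M + 1 letters to the mean of N_i + 1 over
    M letters. *)
Lemma mexp_variance M i : i \in S ->
  Ex M (fun N => ((N i)%:R - M%:R * p i) ^+ 2) = M%:R * p i * (1 - p i).
Proof.
move=> iS; case: M => [|M]; first by rewrite /Ex /= !mul0r subrr expr0n.
pose mu := M.+1%:R * p i.
have -> : Ex M.+1 (fun N => ((N i)%:R - mu) ^+ 2) =
    Ex M.+1 (fun N => (N i)%:R * (N i)%:R + (- 2 * mu * (N i)%:R + mu ^+ 2)).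
  by apply: mexp_ext => N; ring.
rewrite !ExD ExZ mexp_const mexp_mean // (Ex_count _ (fun N => (N i)%:R)) //.
have -> : Ex M (fun N => (incr N i i)%:R) = Ex M (fun N => (N i)%:R + 1).
  by apply: mexp_ext => N; rewrite incr_id natr1.
rewrite ExD mexp_mean // mexp_const /mu -[M.+1%:R]natr1; ring.
Qed.

(* AM-GM: |z| <= (z^2 / s + s) / 2. *)
Lemma mexp_absdev M i s : i \in S -> 0 < s -> M%:R <= s ^+ 2 ->
  Ex M (fun N => `|(N i)%:R - M%:R * p i|) <= s.
Proof.
move=> iS s0 Ms.
apply: (@le_trans _ _ (Ex M (fun N => (2 * s)^-1 * ((N i)%:R - M%:R * p i) ^+ 2 + s / 2))).
  apply: mexp_le => N _; set z := _ - _.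
  rewrite -(ler_pM2l (_ : 0 < 2 * s)) ?mulr_gt0 // mulrDr mulVKf ?gt_eqF ?mulr_gt0 //.
  have := sqr_ge0 (`|z| - s); rewrite sqrrB real_normK ?num_real //.
  move: `|z| (z ^+ 2) => a b; rewrite (_ : 2 * s * (s / 2) = s ^+ 2); last by field.
  by rewrite -mulr_natr; lra.
rewrite ExD ExZ mexp_variance // mexp_const.
have p1 := weight_le1 iS; have /ltW pi0 := p_gt0 iS.
have v1 : M%:R * p i * (1 - p i) <= s ^+ 2.
  apply: le_trans Ms; rewrite -mulrA ler_piMr // mulr_ile1 ?subr_ge0 //.
  by rewrite gerBl.
rewrite -[leRHS](_ : (2 * s)^-1 * s ^+ 2 + s / 2 = s); last by field; rewrite gt_eqF.
by rewrite lerD2r ler_wpM2l // invr_ge0 mulr_ge0 // ltW.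
Qed.

(** [harm_dev_le] leaves three means, each of order 1/s with s the square root of M + 1. A
    denominator N_i + 1 is removed by [Ex_count], which trades it for the factor 1/mu and one more
    letter. *)
Lemma mexp_harm_dev M i s : i \in S -> 0 < s -> s ^+ 2 = M.+1%:R ->
  Ex M (fun N => `|harm R M - harm R (N i) - - ln (p i)|) <= 4 / (p i * s).
Proof.
move=> iS s0 sM; have pi0 := p_gt0 iS; have p1 := weight_le1 iS.
have s1 : 1 <= s.
  have s21 : 1 <= s ^+ 2 by rewrite sM ler1n.
  by nra.
set mu := M.+1%:R * p i; have mu0 : 0 < mu by rewrite mulr_gt0.
apply: (@le_trans _ _ (Ex M (fun N => (N i).+1%:R^-1 +
   (mu^-1 * `|(N i).+1%:R - mu| + `|(N i).+1%:R - mu| / (N i).+1%:R)))).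
  apply: mexp_le => N NM; apply: (le_trans (harm_dev_le (NM i) pi0)).
  by rewrite lerD2l mulrDr [mu^-1 * _]mulrC.
rewrite !ExD ExZ.
have T1 : Ex M (fun N => (N i).+1%:R^-1) <= mu^-1.
  rewrite -[leRHS]mulr1 -(@ler_pM2l _ mu) // mulVKf ?gt_eqF //.
  rewrite (_ : Ex M _ = Ex M (fun N => (incr N i i)%:R^-1)); last first.
    by apply: mexp_ext => N; rewrite incr_id.
  rewrite -(Ex_count _ (fun N => (N i)%:R^-1)) // -[leRHS](mexp_const M.+1 1).
  apply: mexp_le => N _; case: (N i) => [|n]; first by rewrite mul0r.
  by rewrite divff ?pnatr_eq0.
have T2 : Ex M (fun N => `|(N i).+1%:R - mu|) <= s + 1.
  apply: (@le_trans _ _ (Ex M (fun N => `|(N i)%:R - M%:R * p i| + 1))).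
    apply: mexp_le => N _.
    have -> : (N i).+1%:R - mu = ((N i)%:R - M%:R * p i) + (1 - p i).
      by rewrite /mu -!natr1; ring.
    apply: (le_trans (ler_normD _ _)); rewrite lerD2l ger0_norm ?subr_ge0 //.
    by rewrite gerBl ltW.
  rewrite ExD mexp_const lerD2r; apply: mexp_absdev => //.
  by rewrite sM ler_nat.
have T3 : Ex M (fun N => `|(N i).+1%:R - mu| / (N i).+1%:R) <= mu^-1 * s.
  rewrite -(@ler_pM2l _ mu) // mulVKf ?gt_eqF //.
  rewrite (_ : Ex M _ = Ex M (fun N => `|(incr N i i)%:R - mu| / (incr N i i)%:R)); last first.
    by apply: mexp_ext => N; rewrite incr_id.
  rewrite -(Ex_count _ (fun N => `|(N i)%:R - mu| / (N i)%:R)) //.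
  apply: le_trans (mexp_absdev iS s0 (_ : M.+1%:R <= s ^+ 2)); last by rewrite sM.
  apply: mexp_le => N _; case: (N i) => [|n]; first by rewrite mul0r.
  by rewrite mulrCA divff ?pnatr_eq0 // mulr1.
(* The total is at most (1 + (s + 1) + s) / mu, which s >= 1 bounds by 4s / mu; and mu = p_i s^2. *)
apply: (le_trans (lerD T1 (lerD (_ : _ <= mu^-1 * (s + 1)) T3))).
  by rewrite ler_pM2l ?invr_gt0.
rewrite (_ : 4 / (p i * s) = mu^-1 * (4 * s)); last first.
  by rewrite /mu -sM; field; rewrite !gt_eqF.
rewrite -{1}[mu^-1]mulr1 -!mulrDr ler_pM2l ?invr_gt0 //; lra.
Qed.

(** Together with ln (M + 1) this dominates both H_M <= ln (M + 1) + 1 and every |ln p_i|, and it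
    keeps the bound at least 1, as [prod_dist_le] requires. *)
Let C0 : R := 2 + \sum_(i in S) `|ln (p i)|.

Lemma mexp_prod_harm M (A : {set I}) s : A \subset S -> 0 < s -> s ^+ 2 = M.+1%:R ->
  `|Ex M (fun N => \prod_(i in A) (harm R M - harm R (N i))) - \prod_(i in A) - ln (p i)|
  <= (C0 + ln M.+1%:R) ^+ #|A| * \sum_(i in A) 4 / (p i * s).
Proof.
move=> /fintype.subsetP AS s0 sM; set K := C0 + _.
have S0 : 0 <= \sum_(i in S) `|ln (p i)| by exact: sumr_ge0.
have L0 : 0 <= ln M.+1%:R :> R by rewrite ln_ge0 // ler1n.
have K1 : 1 <= K by rewrite /K /C0; lra.
set c := \prod_(i in A) - ln (p i).
pose D N := K ^+ #|A| * \sum_(i in A) `|harm R M - harm R (N i) - - ln (p i)|.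
have dev N : (forall i, (N i <= M)%N) ->
    `|\prod_(i in A) (harm R M - harm R (N i)) - c| <= D N.
  move=> NM; apply: prod_dist_le => // j jA.
    rewrite ger0_norm ?subr_ge0 ?harm_le // lerBlDr.
    apply: (le_trans (harm_le_ln R M)).
    have := harm_le R (leq0n (N j)); rewrite {1}/harm big_ord0 => h0.
    by rewrite /K /C0; lra.
  rewrite normrN; have : `|ln (p j)| <= \sum_(i in S) `|ln (p i)|.
    by rewrite (bigD1 j) ?AS //= lerDl sumr_ge0.
  by rewrite /K /C0; lra.
have ED : Ex M D <= K ^+ #|A| * \sum_(i in A) 4 / (p i * s).
  rewrite /D ExZ; apply: ler_wpM2l; first by rewrite exprn_ge0 // (le_trans _ K1).
  rewrite /Ex mexp_sum; apply: ler_sum => i iA.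
  exact: mexp_harm_dev (AS _ iA) s0 sM.
apply: le_trans ED; rewrite ler_norml; apply/andP; split.
  rewrite -lerN2 opprB opprK -{1}(mexp_const M c) -mulN1r -ExZ -ExD.
  apply: mexp_le => N /dev; rewrite mulN1r distrC; exact: le_trans (ler_norm _).
rewrite -{1}(mexp_const M c) -mulN1r -ExZ -ExD.
apply: mexp_le => N /dev; rewrite mulN1r; exact: le_trans (ler_norm _).
Qed.

End LawOfLargeNumbers.

(** * Limits of the moments and of the truncated zeta and Bell values *)

Section Limits.
Variable R : realType.
Local Open Scope classical_set_scope.

Lemma cvgn_sum (J : Type) (s : seq J) (P : pred J) (f : J -> nat -> R) (l : J -> R) :
  (forall j, P j -> f j n @[n --> \oo] --> l j) ->
  \sum_(j <- s | P j) f j n @[n --> \oo] --> \sum_(j <- s | P j) l j.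
Proof. by move=> fl; apply: cvg_big => //; exact: add_continuous. Qed.

Lemma cvgn_mulrn (f : nat -> R) (l : R) c :
  f n @[n --> \oo] --> l -> f n *+ c @[n --> \oo] --> l *+ c.
Proof. exact: cvgMn. Qed.

Lemma exprn_le_expR (x : R) k : 0 <= x -> x ^+ k <= k`!%:R * expR x.
Proof.
case: k => [|k] x0; first by rewrite expr0 mul1r (le_trans _ (expR_ge1Dx x)) ?lerDl.
rewrite -ler_pdivrMl ?ltr0n ?fact_gt0 // mulrC.
by apply: le_trans (expR_ge1Dxn k x0); rewrite lerDr.
Qed.

(** A power of a logarithm is at most a constant times the fourth root w of n + 1, by x^k <= k! e^x
    at x = C/4 + ln w. The fourth root is small enough against the decay w^-2 of the deviations. *)
Lemma polylog_le (C w : R) n k : 0 <= C -> 0 < w -> w ^+ 4 = n.+1%:R ->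
  (C + ln n.+1%:R) ^+ k <= 4 ^+ k * k`!%:R * expR (C / 4) * w.
Proof.
move=> C0 w0 wn; rewrite -wn lnXn //.
have -> : C + ln w *+ 4 = 4 * (C / 4 + ln w) by rewrite -[ln w *+ 4]mulr_natr; field.
have l0 : 0 <= ln w.
  rewrite -(pmulrn_lge0 _ (ltn0Sn 3)) -lnXn // wn ln_ge0 // ler1n //.
rewrite exprMn -!mulrA ler_pM2l ?exprn_gt0 //.
apply: (le_trans (exprn_le_expR _ _)); first by rewrite addr_ge0 // divr_ge0.
by rewrite expRD lnK ?posrE.
Qed.

Lemma cvg_root4_harmonic : Num.sqrt (Num.sqrt (@harmonic R n)) @[n --> \oo] --> (0 : R).
Proof.
have c : (fun x : R => Num.sqrt (Num.sqrt x)) x @[x --> (0:R)] --> (0:R).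
  have s0 : Num.sqrt (Num.sqrt 0) = 0 :> R by rewrite !sqrtr0.
  rewrite -[X in _ --> X]s0.
  exact: (continuous_comp (@sqrt_continuous R _) (@sqrt_continuous R _)).
exact: (cvg_comp _ _ (@cvg_harmonic R) c).
Qed.

Section Moments.
Variables (I : finType) (p0 : R) (p : I -> R) (S : {set I}).
Hypotheses (p0_ge0 : 0 <= p0) (p_gt0 : forall i, i \in S -> 0 < p i).
Hypothesis mass1 : mass p0 p S = 1.

Lemma cvg_mexp_prod_harm (A : {set I}) : A \subset S ->
  mexp p0 p S M (fun N => \prod_(i in A) (harm R M - harm R (N i)) : R^o) @[M --> \oo]
  --> (\prod_(i in A) - ln (p i) : R).
Proof.
move=> AS; set c := \prod_(i in A) _.
pose C : R := 2 + \sum_(i in S) `|ln (p i)|.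
have C0 : 0 <= C by rewrite addr_ge0 // sumr_ge0.
pose D := 4 ^+ #|A| * (#|A|)`!%:R * expR (C / 4) * \sum_(i in A) (4 / p i).
have A0 : 0 <= \sum_(i in A) 4 / p i.
  by apply: sumr_ge0 => i /(fintype.subsetP AS) /p_gt0 pi0; rewrite divr_ge0 // ltW.
(* Growth w against decay w^-2 leaves w^-1, the fourth root of 1/(M + 1). *)
suff bound M : `|c - mexp p0 p S M (fun N => \prod_(i in A) (harm R M - harm R (N i)) : R^o)|
    <= D * Num.sqrt (Num.sqrt (harmonic M)).
  apply/cvgrPdist_le => e e0.
  have : D * Num.sqrt (Num.sqrt (harmonic M)) @[M --> \oo] --> D * 0.
    exact: cvgM (cvg_cst _) cvg_root4_harmonic.
  rewrite mulr0 => /cvgrPdist_le/(_ e e0); apply: filterS => M.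
  rewrite sub0r normrN => /(le_trans (ler_norm _)); exact: le_trans (bound M).
pose w : R := Num.sqrt (Num.sqrt M.+1%:R).
have w0 : 0 < w by rewrite !sqrtr_gt0.
have w4 : w ^+ 4 = M.+1%:R.
  by rewrite (exprM _ 2 2) sqr_sqrtr ?sqrtr_ge0 // sqr_sqrtr.
have -> : Num.sqrt (Num.sqrt (harmonic M)) = w^-1.
  by rewrite /harmonic /= !sqrtrV.
rewrite distrC; apply: (le_trans (mexp_prod_harm p0_ge0 p_gt0 mass1 AS (s := w ^+ 2) _ _)).
- by rewrite exprn_gt0.
- by rewrite -exprM.
rewrite -/C; apply: (le_trans (ler_wpM2r _ (polylog_le _ C0 w0 w4))).
  apply: sumr_ge0 => i /(fintype.subsetP AS) /p_gt0 pi0.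
  by rewrite divr_ge0 // mulr_ge0 // ?exprn_ge0 // ltW.
have -> : \sum_(i in A) 4 / (p i * w ^+ 2) = (\sum_(i in A) 4 / p i) * w ^- 2.
  by rewrite mulr_suml; apply: eq_bigr => i _; rewrite invfM mulrA.
rewrite /D expr2 invfM; set a := 4 ^+ _ * _ * _; set b := \sum_(i in A) _.
by rewrite le_eqVlt; apply/orP; left; apply/eqP; field; rewrite gt_eqF.
Qed.

Lemma cvg_harm_moment j :
  harm_moment p0 p M S j @[M --> \oo] -->
  (\sum_(A : {set I} | (A \subset S) && (#|A| == j)) \prod_(i in A) - ln (p i) : R).
Proof.
rewrite /harm_moment; under eq_fun do rewrite mexp_sum.
apply: cvgn_sum => A /andP[AS _]; exact: cvg_mexp_prod_harm.
Qed.

End Moments.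

Lemma cvg_zeta k : (2 <= k)%N ->
  (\sum_(i < M) (i.+1%:R ^+ k)^-1 : R) @[M --> \oo] --> zeta R k.
Proof.
move=> k2; pose f n : R := (n.+1%:R ^+ k)^-1.
have f0 n : 0 <= f n by rewrite invr_ge0 exprn_ge0.
under eq_fun do rewrite -(big_mkord predT f).
apply: nondecreasing_is_cvgn; first exact: nondecreasing_series.
exists 2 => _ [M _ <-]; rewrite /series /=.
(* For k >= 2 the terms are dominated by the telescoping differences 1/(M + 1) - 1/(M + 2). *)
have H : \sum_(0 <= i < M.+1) f i <= 2 - M.+1%:R^-1.
  elim: M => [|M IH]; first by rewrite big_nat1 /f expr1n invr1; lra.
  rewrite big_nat_recr //=.
  have : f M.+1 <= M.+1%:R^-1 - M.+2%:R^-1.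
    apply: (@le_trans _ _ (M.+2%:R ^+ 2)^-1).
      rewrite lef_pV2 ?posrE ?exprn_gt0 // ler_weXn2l // ler1n //.
    rewrite -[M.+2%:R]natr1; have : 0 < M.+1%:R :> R by [].
    move: (M.+1%:R) => x x0.
    have -> : x^-1 - (x + 1)^-1 = (x * (x + 1))^-1 by field; rewrite !gt_eqF ?addr_gt0.
    rewrite lef_pV2 ?posrE ?mulr_gt0 ?exprn_gt0 ?addr_gt0 //; nra.
  by move: IH; move: (M.+1%:R^-1) (M.+2%:R^-1) (f _) (\sum_(_ <= _ < _) _) => *; lra.
apply: (@le_trans _ _ (\sum_(0 <= i < M.+1) f i)).
  by rewrite big_nat_recr //= lerDl.
by apply: (le_trans H); rewrite gerBl invr_ge0.
Qed.

Lemma cvg_bell (x : nat -> nat -> R) (y : nat -> R) n :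
  (forall j, x M j @[M --> \oo] --> y j) -> bell (x M) n @[M --> \oo] --> bell y n.
Proof.
move=> xy; have [k] := ubnP n; elim: k n => // k IH [|n] nk; first exact: cvg_cst.
rewrite bellS; under eq_fun do rewrite bellS.
apply: cvgn_sum => s _; apply: cvgM; last first.
  by apply: IH; apply: leq_ltn_trans (leq_subr _ _) _.
by apply: cvgM => //; exact: cvg_cst.
Qed.

Lemma cvg_bell_zeta n :
  bell (zeta_arg_trunc R M) n @[M --> \oo] --> bell (@zeta_arg R) n.
Proof.
apply: cvg_bell => j; rewrite /zeta_arg_trunc /zeta_arg.
case: leqP => j1; first exact: cvg_cst.
by apply: cvgM; [exact: cvg_cst | exact: cvg_zeta].
Qed.

End Limits.

(** * Summation over maps to levels *)

Section LevelSum.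
Variables (R : numFieldType) (I : finType) (p0 : R) (p : I -> R) (L : nat).
Implicit Types (S U : {set I}) (nu : I -> nat).

(* The contribution of the k indices sent to the level n. *)
Definition block (k n : nat) : {poly R} := ('X^k * negbin R L k n) *+ k`!.

(** The summand of one map nu: |K_0|!, the blocks of the levels 1 to M, and the telescoped product
    of the z_i^(n_i) as a product of partial masses. *)
Definition level_term M S nu : {poly R} :=
  ((#|[set j in S | nu j == 0%N]|)`!)%:R *
  (\prod_(n < M) block #|[set j in S | nu j == n.+1]| n.+1 *
   \prod_(n < M) (mass p0 p [set j in S | (nu j <= n)%N])%:P).

(** Maps on S are encoded as maps on all of [I] that vanish off S, so that S can shrink during the
    induction while the type stays fixed. *)
Definition supp_in M S (N : {ffun I -> 'I_M.+1}) : bool :=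
  [forall j, (j \notin S) ==> (N j == 0%N :> nat)].

Lemma level_term_ext M S nu nu' :
  {in S, nu =1 nu'} -> level_term M S nu = level_term M S nu'.
Proof.
move=> nn.
have E (P : pred nat) : [set j in S | P (nu j)] = [set j in S | P (nu' j)].
  by apply/finset.setP => j; rewrite !inE; apply: andb_id2l => /nn ->.
rewrite /level_term (E (fun x => x == 0%N)); congr (_ * (_ * _)).
  by apply: eq_bigr => n _; rewrite (E (fun x => x == n.+1)).
apply: eq_bigr => n _.
by apply: (congr1 (fun X => (mass p0 p X)%:P)); exact: (E (fun x => x <= n)%N).
Qed.

Lemma level_termS M S nu U : (forall j, (nu j <= M.+1)%N) ->
  [set j in S | (nu j <= M)%N] = U ->
  level_term M.+1 S nu =
  block #|S :\: U| M.+1 * (mass p0 p U *: level_term M U nu).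
Proof.
move=> nuM UE.
have E (P : pred nat) : (forall x, P x -> x <= M)%N ->
    [set j in S | P (nu j)] = [set j in U | P (nu j)].
  move=> PM; apply/finset.setP => j; rewrite -UE !inE -andbA; congr (_ && _).
  by case Pj: (P _); rewrite ?andbF // (PM _ Pj).
have T : [set j in S | nu j == M.+1] = S :\: U.
  apply/finset.setP => j; rewrite -UE !inE; case: (j \in S) => //=.
  by rewrite andbT -ltnNge eqn_leq nuM.
rewrite /level_term !big_ord_recr /= UE T (E (fun x => x == 0%N)); last by move=> x /eqP ->.
have -> : \prod_(n < M) block #|[set j in S | nu j == n.+1]| n.+1 =
    \prod_(n < M) block #|[set j in U | nu j == n.+1]| n.+1.
  by apply: eq_bigr => n _; rewrite (E (fun x => x == n.+1)) // => x /eqP ->.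
have -> : \prod_(n < M) (mass p0 p [set j in S | (nu j <= n)%N])%:P =
    \prod_(n < M) (mass p0 p [set j in U | (nu j <= n)%N])%:P.
  apply: eq_bigr => n _; apply: (congr1 (fun X => (mass p0 p X)%:P)).
  by apply: (E (fun x => x <= n)%N) => x xn; exact: leq_trans xn (ltnW (ltn_ord n)).
by rewrite -mul_polyC; ring.
Qed.

(** Unrolls the recursion of [lev]: the maps are grouped by the set U of indices in S not sent to
    the top level. *)
Lemma lev_sum M S :
  lev p0 p L M S =
  \sum_(N : {ffun I -> 'I_M.+1} | supp_in S N) level_term M S (fun j => N j).
Proof.
elim: M S => [|M IH] S.
  rewrite (big_pred1 [ffun=> ord0]) => [|N].
    rewrite /level_term !big_ord0 !mulr1 /=; congr ((#|pred_of_set _|)`!)%:R.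
    by apply/finset.setP => j; rewrite !inE ffunE eqxx andbT.
  apply/forallP/eqP => [_|-> j]; last by rewrite ffunE eqxx implybT.
  by apply/ffunP => j; rewrite !ord1.
rewrite [LHS]/= (partition_big (fun N : {ffun I -> 'I_M.+2} =>
   [set j in S | (N j <= M)%N]) (fun U => U \subset S)); last first.
  by move=> N _; apply/fintype.subsetP => j; rewrite inE => /andP[].
apply: eq_bigr => U US.
(* For fixed U, [ext] sends S \ U to the top level and [res] forgets that level; they are mutually
   inverse between maps supported in U and the fibre over U. *)
pose ext (N : {ffun I -> 'I_M.+1}) : {ffun I -> 'I_M.+2} :=
  [ffun j => if j \in S :\: U then ord_max else widen_ord (leqnSn _) (N j)].
pose res (N : {ffun I -> 'I_M.+2}) : {ffun I -> 'I_M.+1} :=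
  [ffun j => inord (if j \in U then N j : nat else 0%N)].
have extU N : [set j in S | (ext N j <= M)%N] = U.
  apply/finset.setP => j; rewrite inE ffunE inE.
  case jU: (j \in U) => /=; first by rewrite (fintype.subsetP US) //= -ltnS ltn_ord.
  by case: (j \in S); rewrite //= ltnn.
rewrite (reindex_onto ext res) /=; last first.
  move=> N /andP[/forallP NS /eqP UE]; apply/ffunP => j; apply/val_inj.
  rewrite !ffunE; case: ifPn => /=.
    rewrite -UE !inE => /andP[+ jS]; rewrite jS /= -ltnNge => jM.
    by apply/eqP; rewrite eqn_leq jM -ltnS ltn_ord.
  rewrite inE negb_and negbK => jSU; case: ifPn => jU.
    by rewrite inordK //; move: jU; rewrite -UE inE => /andP[].
  move: jSU; rewrite (negPf jU) /= => jS.
  by have /implyP/(_ jS)/eqP -> := NS j; rewrite inordK.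
rewrite IH scaler_sumr mulr_sumr -sumrMnl; apply: eq_big => [N|N NU].
  apply/idP/idP => [/forallP NU|].
    have jU j : j \notin U -> N j = 0%N :> nat.
      by move=> jU; apply/eqP; have /implyP := NU j; exact.
    apply/andP; split; first (apply/andP; split).
    - apply/forallP => j; apply/implyP => jS; rewrite ffunE inE (negPf jS) andbF /=.
      by rewrite jU //; apply: contra jS; move/fintype.subsetP : US; apply.
    - exact/eqP/extU.
    - apply/eqP/ffunP => j; apply/val_inj; rewrite !ffunE inE.
      case: (boolP (j \in U)) => jU' /=; first by rewrite inordK /=.
      by rewrite inordK // jU.
  move=> /andP[_ /eqP hN]; apply/forallP => j; apply/implyP => jU.
  by rewrite -hN ffunE (negPf jU) inordK.
rewrite (level_termS _ (extU N)); last by move=> j; rewrite -ltnS.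
rewrite /block mulrnAl; congr (_ * (_ *: _) *+ _).
apply: level_term_ext => j jU; by rewrite ffunE inE jU.
Qed.

End LevelSum.

(** * Bijection between level maps and pairs of blocks and increasing levels *)

Section Blocks.
Variables (r M s : nat).
Implicit Types (K : {ffun 'I_s -> {set 'I_r}}) (n : {ffun 'I_s -> 'I_M.+1}).
Implicit Types (N : {ffun 'I_r -> 'I_M.+1}).

Definition disjoint_blocks K : bool :=
  pairwise_disjoint K && [forall i, (0 < #|K i|)%N].

(* The map N attached to the sets K i and the levels n i. *)
Definition level_of K n : {ffun 'I_r -> 'I_M.+1} :=
  [ffun j => if [pick i | j \in K i] is Some i then n i else ord0].

Definition values N : {set 'I_M.+1} :=
  [set v : 'I_M.+1 | (0 < v)%N && [exists j, N j == v]].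

Definition cut_vals N : {ffun 'I_s -> 'I_M.+1} :=
  [ffun i : 'I_s => nth ord0 (enum (values N)) i].

(** Inverse construction to [level_of]: the levels are the positive values of N in increasing order,
    the blocks are their fibres. The default [ord0] in [cut_vals] is reached only if N has fewer
    than s positive values. *)
Definition cut_sets N : {ffun 'I_s -> {set 'I_r}} :=
  [ffun i => [set j | N j == cut_vals N i]].

Lemma pairwise_disjoint_inj K i i' j :
  pairwise_disjoint K -> j \in K i -> j \in K i' -> i = i'.
Proof.
move=> /forallP/(_ i)/forallP/(_ i')/implyP D ji ji'.
apply/eqP; apply: contraLR ji' => /D dis.
by rewrite (disjointFr dis).
Qed.

Lemma level_of_in K n i j : pairwise_disjoint K -> j \in K i -> level_of K n j = n i.
Proof.
move=> D ji; rewrite ffunE; case: pickP => [i' ji'|/(_ i)]; last by rewrite ji.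
by rewrite (pairwise_disjoint_inj D ji ji').
Qed.

Lemma level_of_out K n j : (forall i, j \notin K i) -> level_of K n j = ord0.
Proof.
by move=> jK; rewrite ffunE; case: pickP => // i; rewrite (negPf (jK i)).
Qed.

Lemma level_ofP K n j : pairwise_disjoint K ->
  (exists2 i, j \in K i & level_of K n j = n i) \/
  ((forall i, j \notin K i) /\ level_of K n j = ord0).
Proof.
move=> D; case: (pickP (fun i => j \in K i)) => [i ji|jK].
  by left; exists i => //; exact: level_of_in.
by right; split=> [i|]; [rewrite jK | apply: level_of_out => i; rewrite jK].
Qed.

Lemma incr_pos_gt0 n i : incr_pos n -> (0 < n i)%N.
Proof. by move=> /andP[/forallP]. Qed.

Lemma incr_pos_lt n i j : incr_pos n -> (n i < n j)%N = (i < j)%N.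
Proof.
move=> /andP[_ /forallP H].
have mono (x y : 'I_s) : (x < y)%N -> (n x < n y)%N.
  by move: (H x) => /forallP/(_ y)/implyP.
case: (ltngtP i j) => [/mono->//|/mono ji|/val_inj->]; last by rewrite ltnn.
by apply/negbTE; rewrite -leqNgt ltnW.
Qed.

Lemma incr_pos_inj n : incr_pos n -> injective n.
Proof.
move=> Hn i j nij; apply/val_inj/eqP.
have := incr_pos_lt i j Hn; have := incr_pos_lt j i Hn.
by rewrite nij ltnn; case: ltngtP.
Qed.

Lemma level_of_fiber K n i : pairwise_disjoint K -> incr_pos n ->
  [set j | level_of K n j == n i] = K i.
Proof.
move=> D Hn; apply/finset.setP => j; rewrite inE.
apply/eqP/idP => [|ji]; last exact: level_of_in.
have [[i' ji' ->]|[_ ->]] := level_ofP n j D; first by move/(incr_pos_inj Hn) <-.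
by move=> n0; have := incr_pos_gt0 i Hn; rewrite -n0.
Qed.

Lemma level_of_neq0 K n j : pairwise_disjoint K -> incr_pos n ->
  (level_of K n j != 0%N :> nat) = (\sum_(i < s) (j \in K i))%N :> nat.
Proof.
move=> D Hn; have [[i ji ->]|[jK ->]] := level_ofP n j D.
  rewrite -lt0n incr_pos_gt0 // (bigD1 i) //= ji big1 // => i' i'i.
  by apply/eqP; rewrite eqb0; apply: contra i'i => /(pairwise_disjoint_inj D ji) ->.
by rewrite big1 // => i _; rewrite (negPf (jK i)).
Qed.

Lemma card_level_of_neq0 K n : pairwise_disjoint K -> incr_pos n ->
  #|[set j | level_of K n j != 0%N :> nat]| = (\sum_(i < s) #|K i|)%N.
Proof.
move=> D Hn; rewrite -sum1_card big_mkcond /=.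
rewrite (eq_bigr (fun j => \sum_(i < s) (j \in K i)))%N; last first.
  by move=> j _; rewrite inE -(level_of_neq0 _ D Hn); case: (_ != _).
rewrite exchange_big; apply: eq_bigr => i _.
by rewrite -sum1_card [RHS]big_mkcond; apply: eq_bigr => j _; case: (j \in K i).
Qed.

Lemma sorted_enum_ord (A : {set 'I_M.+1}) : sorted (relpre val ltn) (enum A).
Proof.
rewrite /enum_mem sorted_filter //; first exact: (fun x y z => @ltn_trans (val x) (val y) (val z)).
by rewrite -sorted_map -enumT val_enum_ord iota_ltn_sorted.
Qed.

(** Two strictly sorted lists with the same members coincide. Nonempty blocks ensure that every n i
    is attained. *)
Lemma enum_values_level_of K n : disjoint_blocks K -> incr_pos n ->
  enum (values (level_of K n)) = [seq n i | i <- enum 'I_s].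
Proof.
move=> /andP[D /forallP K0] Hn.
have tr : transitive (relpre (val : 'I_M.+1 -> nat) ltn).
  by move=> y x z; exact: ltn_trans.
apply: (@irr_sorted_eq _ _ tr); first by move=> x; exact: ltnn.
- exact: sorted_enum_ord.
- rewrite sorted_map; have : sorted (relpre (val : 'I_s -> nat) ltn) (enum 'I_s).
    by rewrite -sorted_map val_enum_ord iota_ltn_sorted.
  apply: sub_sorted => x y /=; by rewrite incr_pos_lt.
move=> v; rewrite mem_enum inE; apply/andP/mapP => [[v0 /existsP[j /eqP jv]]|[i _ ->]].
  have [[i ji E]|[_ E]] := level_ofP n j D; first by exists i; rewrite ?mem_enum // -jv.
  by move: v0; rewrite -jv E.
split; first exact: incr_pos_gt0.
have /card_gt0P[j ji] := K0 i.
by apply/existsP; exists j; rewrite (level_of_in _ D ji).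
Qed.

Lemma card_values_level_of K n : disjoint_blocks K -> incr_pos n ->
  #|values (level_of K n)| = s.
Proof.
by move=> D Hn; rewrite cardE enum_values_level_of // size_map size_enum_ord.
Qed.

Lemma cut_vals_level_of K n : disjoint_blocks K -> incr_pos n -> cut_vals (level_of K n) = n.
Proof.
move=> D Hn; apply/ffunP => i; rewrite ffunE enum_values_level_of //.
by rewrite (nth_map i) ?size_enum_ord // nth_ord_enum.
Qed.

Lemma cut_sets_level_of K n : disjoint_blocks K -> incr_pos n -> cut_sets (level_of K n) = K.
Proof.
move=> D Hn; apply/ffunP => i; rewrite ffunE cut_vals_level_of //.
by apply: level_of_fiber => //; case/andP: D.
Qed.

Section Cut.
Variable N : {ffun 'I_r -> 'I_M.+1}.
Hypothesis Ns : #|values N| = s.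

Lemma cut_vals_mem i : cut_vals N i \in values N.
Proof. by rewrite ffunE -mem_enum mem_nth // -cardE Ns. Qed.

Lemma incr_pos_cut : incr_pos (cut_vals N).
Proof.
apply/andP; split; first by apply/forallP => i; have := cut_vals_mem i; rewrite inE => /andP[].
apply/forallP => i; apply/forallP => j; apply/implyP => ij; rewrite !ffunE.
have tr : transitive (relpre (val : 'I_M.+1 -> nat) ltn) by move=> y x z; exact: ltn_trans.
by apply: (sorted_ltn_nth tr _ (sorted_enum_ord _)); rewrite // inE -cardE Ns.
Qed.

Lemma disjoint_blocks_cut : disjoint_blocks (cut_sets N).
Proof.
apply/andP; split.
  apply/forallP => i; apply/forallP => j; apply/implyP => ij.
  rewrite -finset.setI_eq0; apply/eqP/finset.setP => x; rewrite ![cut_sets _ _]ffunE !inE.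
  apply/negbTE/negP => /andP[/eqP -> /eqP E].
  by move: ij; rewrite (incr_pos_inj incr_pos_cut E) eqxx.
apply/forallP => i; have := cut_vals_mem i; rewrite inE => /andP[_ /existsP[j jE]].
by apply/card_gt0P; exists j; rewrite ffunE inE.
Qed.

Lemma level_of_cut : level_of (cut_sets N) (cut_vals N) = N.
Proof.
have /andP[D _] := disjoint_blocks_cut.
apply/ffunP => j; have [N0|N0] := posnP (N j).
  rewrite level_of_out; first by apply/val_inj.
  move=> i; rewrite ffunE inE; apply/eqP => E.
  by have := incr_pos_gt0 i incr_pos_cut; rewrite -E N0.
have Nv : N j \in enum (values N) by rewrite mem_enum inE N0; apply/existsP; exists j.
have iN : (index (N j) (enum (values N)) < s)%N by rewrite -Ns cardE index_mem.
have cE : cut_vals N (Ordinal iN) = N j by rewrite ffunE /= nth_index.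
by rewrite (@level_of_in _ _ (Ordinal iN)) // ffunE inE cE.
Qed.

End Cut.

(** [level_of] and the pair [cut_sets], [cut_vals] are inverse bijections; t counts the indices
    outside K_0 and s the distinct positive levels. *)
Lemma sum_blocks (V : nmodType) (F : {ffun 'I_r -> 'I_M.+1} -> V) (t : nat) :
  \sum_(N : {ffun 'I_r -> 'I_M.+1} |
        (#|[set j | N j != 0%N :> nat]| == t) && (#|values N| == s)) F N =
  \sum_(K : {ffun 'I_s -> {set 'I_r}} | disjoint_blocks K && ((\sum_(i < s) #|K i|)%N == t))
    \sum_(n : {ffun 'I_s -> 'I_M.+1} | incr_pos n) F (level_of K n).
Proof.
rewrite pair_big /=.
rewrite (reindex_onto (fun Kn => level_of Kn.1 Kn.2) (fun N => (cut_sets N, cut_vals N))) /=; last first.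
  by move=> N /andP[_ /eqP]; exact: level_of_cut.
apply: eq_bigl => -[K n] /=; apply/idP/idP.
  move=> /andP[/andP[/eqP tE /eqP sE] /eqP[KE nE]].
  have D : disjoint_blocks K by rewrite -KE disjoint_blocks_cut.
  have Hn : incr_pos n by rewrite -nE incr_pos_cut.
  by rewrite D Hn -tE card_level_of_neq0 ?eqxx //; case/andP: D.
move=> /andP[/andP[D /eqP tE] Hn].
rewrite card_values_level_of // cut_sets_level_of // cut_vals_level_of // !eqxx !andbT.
by rewrite card_level_of_neq0 // ?tE //; case/andP: D.
Qed.

End Blocks.

(** * The truncated coefficient as a coefficient of [lev] *)

Section TruncatedCoefficient.
Variable R : realType.

Lemma coef_prod_ffun s e (q : 'I_s -> {poly R}) :
  (\prod_(i < s) q i)`_e =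
  \sum_(l : {ffun 'I_s -> 'I_e.+1} | (\sum_(i < s) l i)%N == e)
     \prod_(i < s) (q i)`_(l i).
Proof.
have H : eqX e.+1 (\prod_(i < s) q i) (\prod_(i < s) \sum_(l < e.+1) (q i)`_l *: 'X^l).
  elim/big_ind2 : _ => [|x y x' y'|i _]; [exact: eqX_refl|exact: eqX_mul|].
  by rewrite -poly_def; apply: coef_eqX => j je; rewrite coef_poly je.
rewrite (eqX_coef H) // bigA_distr_bigA coef_sum [RHS]big_mkcond; apply: eq_bigr => l _.
by rewrite scaler_prod -expr_sum coefZ coefXn eq_sym; case: eqP; rewrite ?mulr1 ?mulr0.
Qed.

Lemma sum_partition_nat (V : nmodType) (T : finType) (P : pred T) (f : T -> nat) B
    (F : T -> V) : (forall x, P x -> (f x <= B)%N) ->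
  \sum_(x | P x) F x = \sum_(0 <= t < B.+1) \sum_(x | P x && (f x == t)) F x.
Proof.
move=> fB; rewrite big_mkord (partition_big (fun x => inord (f x) : 'I_B.+1) predT) //=.
apply: eq_bigr => t _; apply: eq_bigl => x; apply: andb_id2l => /fB fx.
by rewrite -val_eqE /= inordK.
Qed.

Definition Li_trunc (N s : nat) (k : 'I_s -> nat) (z : 'I_s -> R) : R :=
  \sum_(n : {ffun 'I_s -> 'I_N.+1} | incr_pos n)
    \prod_(i < s) (z i ^+ n i / (n i)%:R ^+ k i).

(** The tuple k is determined by K as its cardinalities, so the sum over k disappears. For fixed K
    and n, the sign (-1)^e spreads over the l_i, and the sum over l becomes one coefficient of a
    product of [negbin]. *)
Lemma sum_Li_trunc (r M L s t e : nat)
    (z : {ffun 'I_s -> {set 'I_r}} -> 'I_s -> R) : (e < L)%N ->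
  (-1) ^+ e *
  (\sum_(k : {ffun 'I_s -> 'I_t.+1} |
        [forall i, (0 < k i)%N] && ((\sum_(i < s) k i)%N == t))
  \sum_(l : {ffun 'I_s -> 'I_e.+1} | (\sum_(i < s) l i)%N == e)
    ((r - t)`! * (\prod_(i < s) (k i)`!)
       * \prod_(i < s) 'C(k i + l i - 1, l i))%N%:R *
    \sum_(K : {ffun 'I_s -> {set 'I_r}} |
          pairwise_disjoint K && [forall i, #|K i| == k i])
      Li_trunc M (fun i : 'I_s => (k i + l i)%N) (z K)) =
  \sum_(K : {ffun 'I_s -> {set 'I_r}} | disjoint_blocks K && ((\sum_(i < s) #|K i|)%N == t))
    \sum_(n : {ffun 'I_s -> 'I_M.+1} | incr_pos n)
      (((r - t)`! * \prod_(i < s) (#|K i|)`!)%N%:R *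
        \prod_(i < s) z K i ^+ n i) * (\prod_(i < s) negbin R L #|K i| (n i))`_e.
Proof.
move=> eL.
rewrite [RHS](partition_big (fun K : {ffun 'I_s -> {set 'I_r}} => [ffun i => inord #|K i| : 'I_t.+1])
  (fun k => [forall i, (0 < k i)%N] && ((\sum_(i < s) k i)%N == t))) /=; last first.
  move=> K /andP[/andP[_ /forallP K0] /eqP Kt].
  have Ki i : (#|K i| <= t)%N by rewrite -Kt (bigD1 i) //= leq_addr.
  apply/andP; split; first by apply/forallP => i; rewrite ffunE inordK ?ltnS.
  by apply/eqP; rewrite -[RHS]Kt; apply: eq_bigr => i _; rewrite ffunE inordK ?ltnS.
rewrite mulr_sumr; apply: eq_bigr => k /andP[/forallP k0 /eqP kt].
transitivity (\sum_(K : {ffun 'I_s -> {set 'I_r}} |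
      pairwise_disjoint K && [forall i, #|K i| == k i])
    \sum_(n : {ffun 'I_s -> 'I_M.+1} | incr_pos n)
    \sum_(l : {ffun 'I_s -> 'I_e.+1} | (\sum_(i < s) l i)%N == e)
      (-1) ^+ e * ((((r - t)`! * (\prod_(i < s) (k i)`!)
       * \prod_(i < s) 'C(k i + l i - 1, l i))%N%:R *
      \prod_(i < s) (z K i ^+ n i / (n i)%:R ^+ (k i + l i))))).
  under [RHS]eq_bigr => K _ do rewrite exchange_big /=.
  rewrite [RHS]exchange_big /= mulr_sumr; apply: eq_bigr => l _.
  rewrite !mulr_sumr; apply: eq_bigr => K _.
  by rewrite /Li_trunc !mulr_sumr.
apply: eq_big => [K|K /andP[_ /forallP Kk]].
  apply/andP/andP => [[D /forallP Kk]|[/andP[/andP[D _] /eqP Kt] /eqP Kk]].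
    split; last by apply/eqP/ffunP => i; rewrite ffunE (eqP (Kk i)) inord_val.
    apply/andP; split; last by rewrite -kt; apply/eqP/eq_bigr => i _; exact/eqP.
    by apply/andP; split => //; apply/forallP => i; rewrite (eqP (Kk i)).
  split=> //; apply/forallP => i; rewrite -Kk ffunE inordK // ltnS.
  by rewrite -Kt (bigD1 i) //= leq_addr.
apply: eq_bigr => n _; rewrite coef_prod_ffun mulr_sumr; apply: eq_bigr => l /eqP le.
have -> : (\prod_(i < s) (#|K i|)`! = \prod_(i < s) (k i)`!)%N.
  by apply: eq_bigr => i _; rewrite (eqP (Kk i)).
have -> : \prod_(i < s) (negbin R L #|K i| (n i))`_(l i) =
    \prod_(i < s) ((-1) ^+ l i * ('C(k i + l i - 1, l i)%:R / (n i)%:R ^+ (k i + l i))).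
  apply: eq_bigr => i _.
  by rewrite (eqP (Kk i)) coef_poly (leq_trans (ltn_ord (l i))) // mulrA.
rewrite !big_split /= -expr_sum le !natrM -!natr_prod.
ring.
Qed.

Section Glue.
Variables (r M : nat) (omega : 'I_r -> R) (a : R).
Hypotheses (omega_gt0 : forall i, 0 < omega i) (a_ge0 : 0 <= a) (r_gt0 : (0 < r)%N).
Let A := a + wsum omega [set: 'I_r].
Let p0 := a / A.
Let p i := omega i / A.

Lemma wsum_gt0 (U : {set 'I_r}) i : i \in U -> 0 < a + wsum omega U.
Proof.
move=> iU; apply: ltr_wpDl => //; rewrite /wsum (bigD1 i) //=.
by apply: ltr_pwDl => //; apply: sumr_ge0 => j _; exact/ltW.
Qed.

Lemma mass_wsum U : mass p0 p U = (a + wsum omega U) / A.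
Proof. by rewrite /mass /wsum mulrDl mulr_suml. Qed.

Lemma total_gt0 : 0 < A.
Proof. by apply: (@wsum_gt0 _ (Ordinal r_gt0)); rewrite inE. Qed.

Lemma mass_setT : mass p0 p [set: 'I_r] = 1.
Proof. by rewrite mass_wsum divff // gt_eqF // total_gt0. Qed.

Section Fixed.
Variables (s : nat) (K : {ffun 'I_s -> {set 'I_r}}) (n : {ffun 'I_s -> 'I_M.+1}).
Hypotheses (DK : disjoint_blocks K) (Hn : incr_pos n).

Let D : pairwise_disjoint K. Proof. by case/andP: DK. Qed.

(** As n is increasing, the indices with level at most v form an initial segment; c is the first
    index beyond v, or s if there is none. *)
Lemma incr_pos_threshold v : exists2 c, (c <= s)%N & forall i, (n i <= v)%N = (i < c)%N.
Proof.
case: (pickP (fun i => (v < n i)%N)) => [i0 vi0|nv]; last first.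
  by exists s => // i; rewrite ltn_ord leqNgt nv.
case: (@arg_minnP _ i0 (fun i => (v < n i)%N) (fun i => i : nat) vi0) => i vi imin.
exists i => [|j]; first exact: ltnW.
case: (ltnP j i) => [ji|ij]; first by rewrite leqNgt; apply: contraTN ji => /imin; rewrite -leqNgt.
apply/negbTE; rewrite -ltnNge (leq_trans vi) //.
by move: ij; rewrite leq_eqVlt => /predU1P[/val_inj ->//|]; rewrite -(incr_pos_lt _ _ Hn) => /ltnW.
Qed.

Lemma level_of_le v c : (forall i, (n i <= v)%N = (i < c)%N) ->
  [set j in [set: 'I_r] | (level_of K n j <= v)%N] = Kupto K c.
Proof.
move=> vc; apply/finset.setP => j; rewrite !inE.
have [[i ji ->]|[jK ->]] := level_ofP n j D.
  have -> : j \in \bigcup_(i < s) K i by apply/bigcupP; exists i.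
  rewrite /= vc; apply/idP/bigcupP => [ic|[i' i'c ji']]; first by exists i.
  by rewrite (pairwise_disjoint_inj D ji ji').
rewrite (_ : j \in \bigcup_(i < s) K i = false) //.
by apply/negbTE/negP => /bigcupP[i _]; rewrite (negPf (jK i)).
Qed.

Lemma prod_zarg c : (c <= s)%N ->
  \prod_(i < s | (c <= i)%N) zarg omega a K i = (a + wsum omega (Kupto K c)) / A.
Proof.
pose B k := a + wsum omega (Kupto K k).
have Ks : Kupto K s = [set: 'I_r].
  apply/finset.setP => j; rewrite !inE.
  have -> : \bigcup_(i < s | (i < s)%N) K i = \bigcup_(i < s) K i.
    by apply: eq_bigl => i; rewrite ltn_ord.
  by rewrite orNb.
have BsA : B s = A by rewrite /B Ks.
(* [B 0] vanishes when a = 0 and K_0 is empty. For k > 0 a nonempty block makes [B k] positive, and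
   the telescoping divides by no other terms. *)
have B_neq0 k : (0 < k <= s)%N -> B k != 0.
  case: k => // k /= ks; have /andP[_ /forallP/(_ (Ordinal ks))/card_gt0P[j jK]] := DK.
  rewrite gt_eqF // (@wsum_gt0 _ j) // !inE; apply/orP; right.
  by apply/bigcupP; exists (Ordinal ks).
rewrite leq_eqVlt => /predU1P[->|cs].
  rewrite big_pred0 => [|i]; last by rewrite leqNgt ltn_ord.
  by rewrite -/(B s) BsA divff // gt_eqF // total_gt0.
rewrite -(@big_geq_mkord _ _ _ c s predT (fun i => B i / B i.+1)) /=.
rewrite (eq_bigr (fun i => (B i.+1 / B i)^-1)); last by move=> i _; rewrite invf_div.
rewrite prodfV telescope_prodf // => [|k /andP[ck ks]]; first by rewrite invf_div BsA.
by rewrite B_neq0 // (leq_trans _ ck) //= ltnW.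
Qed.

(** The mass at v is the product of the z_i with n_i > v, so z_i occurs once for each v < n_i. *)
Lemma prod_mass_level_of :
  \prod_(v < M) mass p0 p [set j in [set: 'I_r] | (level_of K n j <= v)%N] =
  \prod_(i < s) zarg omega a K i ^+ n i.
Proof.
transitivity (\prod_(v < M) \prod_(i < s | (v < n i)%N) zarg omega a K i).
  apply: eq_bigr => v _; have [c cs vc] := incr_pos_threshold v.
  rewrite mass_wsum (level_of_le vc) -prod_zarg //; apply: eq_bigl => i.
  by rewrite ltnNge vc -leqNgt.
rewrite (exchange_big_dep predT) //=; apply: eq_bigr => i _.
rewrite -(big_ord_widen _ (fun=> zarg omega a K i)) ?prodr_const ?card_ord //.
by rewrite -ltnS.
Qed.

Lemma level_term_level_of L : (0 < L)%N ->
  level_term p0 p L M [set: 'I_r] (fun j => level_of K n j) =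
  ((r - \sum_(i < s) #|K i|)`!)%N%:R *
  (\prod_(i < s) block R L #|K i| (n i) * (\prod_(i < s) zarg omega a K i ^+ n i)%:P).
Proof.
move=> L0; rewrite /level_term -prod_mass_level_of rmorph_prod.
have -> : #|[set j in [set: 'I_r] | level_of K n j == 0%N :> nat]| = (r - \sum_(i < s) #|K i|)%N.
  rewrite -(card_level_of_neq0 D Hn); pose Z := [set j | level_of K n j != 0%N :> nat]; rewrite -/Z.
  have -> : [set j in [set: 'I_r] | level_of K n j == 0%N :> nat] = ~: Z.
    by apply/finset.setP => j; rewrite !inE negbK.
  apply/eqP; rewrite -(eqn_add2l #|Z|) finset.cardsC card_ord subnKC //.
  by have := max_card (mem Z); rewrite card_ord.
congr (_ * (_ * _)).
pose B (v : nat) := block R L #|[set j in [set: 'I_r] | level_of K n j == v :> nat]| v.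
transitivity (\prod_(v : 'I_M.+1 | v != ord0) B v).
  by rewrite [RHS]big_mkcond big_ord_recl /= mul1r.
have fib i : [set j in [set: 'I_r] | level_of K n j == n i :> nat] = K i.
  by rewrite -(level_of_fiber i D Hn); apply/finset.setP => j; rewrite !inE val_eqE.
(* Levels that are no n i carry an empty block, which contributes 1 by [negbin0]. *)
rewrite (bigID (fun v => v \in [set n i | i in 'I_s])) /= [X in _ * X]big1 ?mulr1.
  rewrite (eq_bigl (fun v => v \in [set n i | i in 'I_s])) => [|v].
    rewrite big_imset /=; last by move=> x y _ _; exact: incr_pos_inj.
    by apply: eq_bigr => i _; rewrite /B fib.
  apply: andb_idl => /imsetP[i _ ->]; rewrite -val_eqE /= -lt0n.
  exact: incr_pos_gt0.
move=> v /andP[v0 vn]; rewrite /B (_ : #|_| = 0%N).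
  by rewrite /block expr0 mul1r negbin0 // fact0 mulr1n.
apply: eq_card0 => j; rewrite !inE; apply/negbTE.
have [[i ji ->]|[_ ->]] := level_ofP n j D.
  by apply: contra vn => /eqP/val_inj <-; apply/imsetP; exists i.
by rewrite eq_sym.
Qed.

Lemma coef_level_term_level_of L m : (0 < L)%N ->
  (level_term p0 p L M [set: 'I_r] (fun j => level_of K n j))`_m =
  if ((\sum_(i < s) #|K i|)%N <= m)%N then
   (((r - (\sum_(i < s) #|K i|)%N)`! * \prod_(i < s) (#|K i|)`!)%N%:R *
      \prod_(i < s) zarg omega a K i ^+ n i)
    * (\prod_(i < s) negbin R L #|K i| (n i))`_(m - \sum_(i < s) #|K i|)%N
  else 0.
Proof.
move=> L0; rewrite level_term_level_of //; set t := (\sum_(i < s) #|K i|)%N.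
have -> : \prod_(i < s) block R L #|K i| (n i) =
   'X^t * ((\prod_(i < s) (#|K i|)`!)%N%:R%:P * \prod_(i < s) negbin R L #|K i| (n i)).
  rewrite /t expr_sum natr_prod rmorph_prod -!big_split; apply: eq_bigr => i _ /=.
  by rewrite /block mul_polyC scaler_nat mulrnAr.
set Q := \prod_(i < s) negbin _ _ _ _; set z := \prod_(i < s) _; set c := (\prod_(i < s) _)%N.
rewrite (_ : _ * _ = 'X^t * ((((r - t)`! * c)%N%:R * z) *: Q)); last first.
  by rewrite -mul_polyC natrM !rmorphM /= !polyC_natr; ring.
by rewrite coefXnM coefZ ltnNge; case: leqP.
Qed.

End Fixed.

Lemma card_values_le (N : {ffun 'I_r -> 'I_M.+1}) :
  (#|values N| <= #|[set j | N j != 0%N :> nat]|)%N.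
Proof.
apply: leq_trans (leq_imset_card N _); apply: subset_leq_card.
apply/fintype.subsetP => v; rewrite inE => /andP[v0 /existsP[j /eqP jv]].
by apply/imsetP; exists j; rewrite // inE jv -lt0n.
Qed.

(** With t the number of nonzero N j, the term is divisible by X^t, which settles t > m; for t = 0
    it is constant while m > 0. This matches the range of t in the definition of c_{r,m}. *)
Lemma coef_level_term_eq0 (N : {ffun 'I_r -> 'I_M.+1}) L m : (0 < L)%N -> (0 < m)%N ->
  ~~ (0 < #|[set j | N j != 0%N :> nat]| <= m)%N ->
  (level_term p0 p L M [set: 'I_r] (fun j => N j))`_m = 0.
Proof.
move=> L0 m0 tm; have [s sN] : exists s, #|values N| = s by exists #|values N|.
have D := disjoint_blocks_cut sN; have Hn := incr_pos_cut sN.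
have := card_level_of_neq0 (proj1 (andP D)) Hn.
have := coef_level_term_level_of D Hn m L0.
rewrite (level_of_cut sN) => -> tE; rewrite tE in tm.
case: ifP => // tm'; move: tm; rewrite tm' andbT -eqn0Ngt => /eqP t0.
have s0 : s = 0%N.
  by apply/eqP; rewrite -leqn0 -sN (leq_trans (card_values_le N)) // tE t0.
rewrite t0 [\prod_(i < s) negbin _ _ _ _]big1 => [|i _].
  by rewrite coef1 !subn0 gtn_eqF ?mulr0.
by have := ltn_ord i; rewrite {2}s0.
Qed.

Definition c_trunc (m : nat) : R :=
  \sum_(1 <= t < (minn m r).+1) (-1) ^+ (m - t) *
  \sum_(1 <= s < t.+1)
  \sum_(k : {ffun 'I_s -> 'I_t.+1} |
        [forall i, (0 < k i)%N] && ((\sum_(i < s) k i)%N == t))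
  \sum_(l : {ffun 'I_s -> 'I_(m - t).+1} | (\sum_(i < s) l i)%N == (m - t)%N)
    ((r - t)`! * (\prod_(i < s) (k i)`!)
       * \prod_(i < s) 'C(k i + l i - 1, l i))%N%:R *
    \sum_(K : {ffun 'I_s -> {set 'I_r}} |
          pairwise_disjoint K && [forall i, #|K i| == k i])
      Li_trunc M (fun i : 'I_s => (k i + l i)%N) (zarg omega a K).

(** Sort the maps N by t and s, discard the t that cannot contribute, and translate each class by
    [sum_blocks]. The class s = 0 is empty because t > 0. *)
Lemma c_trunc_lev m : (1 <= m <= r)%N ->
  c_trunc m = (lev p0 p r.+1 M [set: 'I_r])`_m.
Proof.
move=> /andP[m0 mr]; rewrite /c_trunc (minn_idPl mr) lev_sum coef_sum.
pose tN (N : {ffun 'I_r -> 'I_M.+1}) := #|[set j | N j != 0%N :> nat]|.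
pose g (N : {ffun 'I_r -> 'I_M.+1}) :=
  (level_term p0 p r.+1 M [set: 'I_r] (fun j => N j))`_m.
rewrite [RHS](eq_bigl predT) => [|N]; last by apply/forallP => j; rewrite inE.
have tr N : predT N -> (tN N <= r)%N.
  by move=> _; have := max_card (mem [set j | N j != 0%N :> nat]); rewrite card_ord.
rewrite [RHS](sum_partition_nat _ tr) [RHS](big_cat_nat (n := m.+1)) //=.
rewrite [X in _ = _ + X]big_nat_cond [X in _ = _ + X]big1 ?addr0; last first.
  move=> t /andP[/andP[mt _] _]; apply: big1 => N /eqP tE.
  by apply: coef_level_term_eq0 => //; rewrite -/(tN N) tE [(t <= m)%N]leqNgt mt andbF.
rewrite [RHS]big_ltn // [X in _ = X + _]big1 ?add0r; last first.
  move=> N /eqP tE; apply: coef_level_term_eq0 => //; by rewrite -/(tN N) tE.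
apply: eq_big_nat => t /andP[t0 tm].
have sB N : tN N == t -> (#|values N| <= t)%N by move=> /eqP <-; exact: card_values_le.
rewrite [RHS](sum_partition_nat _ sB) [RHS]big_ltn //.
rewrite [X in _ = X + _](sum_blocks 0 g t) [X in _ = X + _]big_pred0 ?add0r; last first.
  by move=> K; rewrite big_ord0 (ltn_eqF t0) andbF.
rewrite mulr_sumr; apply: eq_big_nat => s /andP[s0 st].
rewrite (@sum_Li_trunc r M r.+1 s t (m - t)%N (zarg omega a)); last first.
  by rewrite ltnS (leq_trans (leq_subr _ _)).
rewrite [RHS](sum_blocks s g t); apply: eq_bigr => K /andP[D /eqP Kt].
apply: eq_bigr => n Hn; rewrite /g (coef_level_term_level_of D Hn) // Kt.
by rewrite -ltnS tm.
Qed.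

End Glue.
End TruncatedCoefficient.

(** * Passage to the limit *)

Section Convergence.
Variable R : realType.
Local Open Scope classical_set_scope.

Lemma Li_trunc_le (s N : nat) (k : 'I_s -> nat) (z : 'I_s -> R) :
  (forall i, 0 <= z i) -> Li_trunc N k z <= Li_trunc N.+1 k z.
Proof.
move=> z0; rewrite /Li_trunc.
rewrite [leRHS](bigID (fun n : {ffun 'I_s -> 'I_N.+2} => [forall i, (n i <= N)%N])) /=.
pose wid (n : {ffun 'I_s -> 'I_N.+1}) : {ffun 'I_s -> 'I_N.+2} :=
  [ffun i => widen_ord (leqnSn _) (n i)].
pose res (n : {ffun 'I_s -> 'I_N.+2}) : {ffun 'I_s -> 'I_N.+1} := [ffun i => inord (n i)].
rewrite [X in _ <= X + _](reindex_onto wid res) /=; last first.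
  move=> n /andP[_ /forallP nN]; apply/ffunP => i; apply/val_inj.
  by rewrite !ffunE /= inordK // ltnS.
rewrite -[leLHS]addr0; apply: lerD; last first.
  by apply: sumr_ge0 => n _; apply: prodr_ge0 => i _; rewrite divr_ge0 // exprn_ge0.
rewrite le_eqVlt; apply/orP; left; apply/eqP; apply: eq_big => [n|n _]; last first.
  by apply: eq_bigr => i _; rewrite ffunE.
have -> : res (wid n) == n.
  by apply/eqP/ffunP => i; apply/val_inj; rewrite !ffunE /= inordK.
rewrite andbT /incr_pos.
have -> : [forall i, (wid n i <= N)%N].
  by apply/forallP => i; rewrite ffunE /= -ltnS ltn_ord.
rewrite andbT; congr (_ && _); first by apply: eq_forallb => i; rewrite ffunE.
by apply: eq_forallb => i; apply: eq_forallb => j; rewrite !ffunE.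
Qed.

Lemma sum_geometric_le (z : R) N : 0 <= z < 1 -> \sum_(i < N) z ^+ i <= (1 - z)^-1.
Proof.
move=> /andP[z0 z1]; have z1' : 0 < 1 - z by rewrite subr_gt0.
rewrite -(ler_pM2l z1') divff ?gt_eqF //.
by rewrite -opprB mulNr -subrX1 opprB gerBl exprn_ge0.
Qed.

(** The terms are nonnegative and the truncations are bounded by a product of geometric series, so
    the [limn] in [Li] is a genuine limit. *)
Lemma cvg_Li_trunc (s : nat) (k : 'I_s -> nat) (z : 'I_s -> R) :
  (forall i, 0 <= z i < 1) -> Li_trunc N k z @[N --> \oo] --> Li k z.
Proof.
move=> z01; have z0 i : 0 <= z i by case/andP: (z01 i).
apply: nondecreasing_is_cvgn; first by apply/nondecreasing_seqP => N; exact: Li_trunc_le.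
exists (\prod_(i < s) (1 - z i)^-1) => _ [N _ <-].
apply: (@le_trans _ _ (\prod_(i < s) \sum_(j < N.+1) z i ^+ j)); last first.
  by apply: ler_prod => i _; rewrite sum_geometric_le // sumr_ge0 // => j _; rewrite exprn_ge0.
rewrite bigA_distr_bigA /Li_trunc big_mkcond; apply: ler_sum => n _.
case: ifPn => [Hn|_]; last by apply: prodr_ge0 => i _; rewrite exprn_ge0.
apply: ler_prod => i _; rewrite divr_ge0 ?exprn_ge0 //=.
rewrite ler_piMr ?exprn_ge0 // invf_le1 ?exprn_gt0 ?ltr0n ?incr_pos_gt0 //.
by rewrite exprn_ege1 // ler1n incr_pos_gt0.
Qed.

Section Coefficient.
Variables (r : nat) (omega : 'I_r -> R) (a : R).
Hypotheses (omega_gt0 : forall i, 0 < omega i) (a_ge0 : 0 <= a).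

Lemma wsum_lt (U V : {set 'I_r}) j : U \subset V -> j \in V -> j \notin U ->
  wsum omega U < wsum omega V.
Proof.
move=> /fintype.subsetP UV jV jU; rewrite /wsum (bigD1 j jV) /=.
apply: (@le_lt_trans _ _ (\sum_(i in V | i != j) omega i)); last by rewrite ltrDr.
rewrite big_mkcond [leRHS]big_mkcond; apply: ler_sum => i _.
case: ifPn => iU; last by case: ifP => // _; exact: ltW.
by rewrite UV //= (_ : i != j) //; apply: contraNneq jU => <-.
Qed.

(** The inequality is strict because the numerator lacks the positive weights of the nonempty block
    K i. *)
Lemma zarg_lt1 s (K : {ffun 'I_s -> {set 'I_r}}) i : disjoint_blocks K ->
  0 <= zarg omega a K i < 1.
Proof.
move=> /andP[D /forallP/(_ i)/card_gt0P[j ji]].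
have jK : j \in Kupto K i.+1.
  by rewrite !inE; apply/orP; right; apply/bigcupP; exists i.
have pos : 0 < a + wsum omega (Kupto K i.+1) by exact: wsum_gt0 jK.
rewrite /zarg divr_ge0 /=; last 2 first.
- by rewrite addr_ge0 // sumr_ge0 // => x _; exact: ltW.
- exact: ltW.
rewrite ltr_pdivrMr // mul1r ltrD2l; apply: (@wsum_lt _ _ j) => //.
  apply: finset.setUS; apply/bigcupsP => i' i'i.
  by apply: (finset.bigcup_sup i'); rewrite ltnW.
rewrite !inE negb_or negbK; apply/andP; split; first by apply/bigcupP; exists i.
apply/bigcupP => -[i' i'i ji'].
by move: i'i; rewrite (pairwise_disjoint_inj D ji' ji) ltnn.
Qed.

Lemma cvg_c_trunc m : c_trunc M omega a m @[M --> \oo] --> c_coef m omega a.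
Proof.
apply: cvgn_sum => t _; apply: cvgM; first exact: cvg_cst.
apply: cvgn_sum => s _; apply: cvgn_sum => k /andP[/forallP k0 _].
apply: cvgn_sum => l _; apply: cvgM; first exact: cvg_cst.
apply: cvgn_sum => K /andP[D /forallP Kk]; apply: cvg_Li_trunc => i.
apply: zarg_lt1; rewrite /disjoint_blocks D.
by apply/forallP => j; rewrite (eqP (Kk j)).
Qed.

End Coefficient.
End Convergence.

Theorem theorem6p2 (R : realType) (r m : nat) (omega : 'I_r -> R) (a : R)
    (hr : (0 < r)%N) (homega : forall i : 'I_r, 0 < omega i) (ha : 0 <= a)
    (hm : (1 <= m <= r)%N) :
  c_coef m omega a =
  \sum_(0 <= k < m.+1)
    (-1) ^+ (m - k) * (((r - m + k)`!)%:R / (k`!)%:R) *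
    Lam (m - k) (fun i : 'I_r => omega i / (a + wsum omega [set: 'I_r])) *
    bell (@zeta_arg R) k.
Proof.
have A0 := total_gt0 homega ha hr.
set A := a + wsum omega [set: 'I_r] in A0 *.
have mr : (m <= r)%N by case/andP: hm.
have cT : #|[set: 'I_r]| = r by rewrite cardsT card_ord.
have p0_ge0 : 0 <= a / A by rewrite divr_ge0 // ltW.
have p_gt0 i : i \in [set: 'I_r] -> 0 < omega i / A by move=> _; rewrite divr_gt0.
have mass1 := mass_setT homega ha hr; rewrite -/A in mass1.
(* The truncated coefficient has two limits, one from its definition and one from the closed form;
   they must agree. *)
have H1 : (c_trunc M omega a m @[M --> \oo] --> c_coef m omega a)%classic.
  exact: cvg_c_trunc.
have H2 : (c_trunc M omega a m @[M --> \oo] --> \sum_(k < m.+1)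
    bell (@zeta_arg R) k / k`!%:R *
    ((\sum_(J : {set 'I_r} | (J \subset [set: 'I_r]%SET) && (#|J| == m - k)%N)
        \prod_(i in J) - ln (omega i / A)) *+ (r - (m - k))`!))%classic.
  have E M : c_trunc M omega a m = \sum_(k < m.+1)
      bell (zeta_arg_trunc R M) k / k`!%:R *
      (harm_moment (a / A) (fun i => omega i / A) M [set: 'I_r] (m - k)%N *+ (r - (m - k))`!).
    rewrite (c_trunc_lev M homega ha hr hm) coef_lev ?cT //.
  under eq_fun do rewrite E.
  apply: cvgn_sum => k _; apply: cvgM.
    by apply: cvgM; [exact: cvg_bell_zeta|exact: cvg_cst].
  apply: cvgn_mulrn.
  exact: (@cvg_harm_moment R _ _ (fun i => omega i / A) _ p0_ge0 p_gt0 mass1 (m - k)%N).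
rewrite (cvg_unique _ H1 H2) // big_mkord; apply: eq_bigr => k _.
have km : (k <= m)%N by rewrite -ltnS.
rewrite /Lam (_ : (r - (m - k))%N = (r - m + k)%N); last by rewrite subnBA // addnBAC.
set X := \sum_(J : {set 'I_r} | _) _; set Y := \sum_(J : {set 'I_r} | _) _.
(* Each of the m - k factors - log contributes one sign. *)
have -> : X = (-1) ^+ (m - k) * Y.
  rewrite mulr_sumr; apply: eq_big => [J|J /andP[_ /eqP <-]]; last exact: prodrN.
  by rewrite finset.subsetT.
by rewrite -mulr_natr; ring.
Qed.
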